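(* Let $G$ be a group generated by an approximate subgroup $\Lambda$. Then there exist a second countable locally compact topological group $\mathsf{H}$, a compact normal subset $\mathsf{Sh}\subset\mathsf{H}$, and a quasi-homomorphism $f:G\to(\mathsf{H}:\mathsf{Sh})$ such that: (1) For $C\subset\mathsf{H}$ compact, $f^{-1}(C)$ is contained in some $\Lambda^i$. (2) For each $i$ there exists a compact $C\subset\mathsf{H}$ with $\Lambda^i\subset f^{-1}(C)$. (3) Specifically, $f^{-1}(\mathsf{Sh})\subset\Lambda^{12}$. (4) Let $X,X'$ be compact subsets of $\mathsf{H}$ with $\mathsf{Sh}^2X\cap\mathsf{Sh}^2X'=\emptyset$. Then there exist disjoint definable subsets $D,D'$ of $\Lambda^k$, for some $k$ (with parameters in $\Lambda$), such that $f^{-1}(X)\subset D$ and $f^{-1}(X')\subset D'$.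
   Context: A symmetric subset $\Lambda$ of a group ($1\in\Lambda=\Lambda^{-1}$) is an approximate subgroup if $\Lambda$ and $\Lambda^2=\{ab:a,b\in\Lambda\}$ are commensurable, i.e. each is covered by finitely many right translates of the other. $\Lambda^i$ is the set of products of $i$ elements of $\Lambda$. A subset of a group is normal if it is invariant under conjugation. For $K\subset H$, a quasi-homomorphism $f:G\to(H:K)$ is a map $f:G\to H$ with $f(1)=1$ and $f(xy^{-1})\in f(x)f(y^{-1})K$ for all $x,y\in G$. Definability refers to first-order definability in $G$ viewed as the piecewise definable group $G=\bigcup_n\Lambda^n$: the many-sorted structure with sorts $\Lambda^n$, the inclusions $\Lambda^n\to\Lambda^{n+1}$ and the multiplication maps $\Lambda^n\times\Lambda^m\to\Lambda^{n+m}$. *)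

(* Defs.v *)
From HB Require Import structures.
From mathcomp Require Import all_boot.
From mathcomp Require Import all_classical.
From mathcomp Require Import topology.

Set Implicit Arguments.
Unset Strict Implicit.
Unset Printing Implicit Defensive.

Local Open Scope classical_set_scope.
Local Open Scope group_scope.

HB.mixin Record isTopologicalGroup T & Topological T & Group T := {
  mulg_continuous : continuous (fun xy : T * T => xy.1 * xy.2) ;
  invg_continuous : continuous (fun x : T => x^-1) ;
}.

#[short(type="topologicalGroupType")]
HB.structure Definition TopologicalGroup :=
  {T of Topological T & Group T & isTopologicalGroup T}.

Section GroupSubsets.
Context {G : groupType}.
Implicit Types A B K : set G.

Definition mulset A B : set G := [set a * b | a in A & b in B].

(** By the definition of [iterop], [expset A 0] is [[set 1]], while
    [expset A 1] and [expset A 2] are convertible to [A] and [mulset A A]. *)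
Definition expset A n : set G := iterop n mulset A [set 1].

Lemma expsetS A n : expset A n.+1 = mulset A (expset A n).
Proof.
case: n => [|//]; apply/seteqP; split => x /=.
  by move=> Ax; exists x => //; exists 1 => //; rewrite mulg1.
by case=> a Aa [_ -> <-]; rewrite mulg1.
Qed.

Lemma expsetD A n m x y :
  expset A n x -> expset A m y -> expset A (n + m) (x * y).
Proof.
elim: n x => [|n IHn] x; first by move=> -> Ay; rewrite mul1g.
rewrite addSn !expsetS => -[a Aa [b Ab <-]] Ay.
by exists a => //; exists (b * y); [exact: IHn | rewrite mulgA].
Qed.

Definition is_subgroup K := K 1 /\ forall x y, K x -> K y -> K (x / y).

Definition generated_by A := smallest is_subgroup A = [set: G].

Definition covered_by_translates A B :=
  exists2 F : set G, finite_set F &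
    A `<=` \bigcup_(g in F) [set b * g | b in B].

Definition commensurable A B :=
  covered_by_translates A B /\ covered_by_translates B A.

Definition approximate_subgroup A :=
  [/\ A 1, A = [set x^-1 | x in A] & commensurable A (expset A 2)].

(** In [groupType], [x ^ y] is the conjugate [y^-1 * x * y]. *)
Definition normal_subset A := forall x y : G, A x -> A (x ^ y).

End GroupSubsets.

Definition quasi_homomorphism (G H : groupType) (K : set H) (f : G -> H) :=
  f 1 = 1 /\
  forall x y : G, exists2 k, K k & f (x / y) = f x * f (y^-1) * k.

(** First-order logic of the piecewise definable group: sort [n] is the n-th
    power of the approximate subgroup, and a variable is a pair (sort, index). *)

Definition fovar : eqType := (nat * nat)%type.

Inductive foterm : nat -> Type :=
| FoVar (p : fovar) : foterm p.1
| FoIncl n (t : foterm n) : foterm n.+1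
| FoMul n m (s : foterm n) (t : foterm m) : foterm (n + m).

Inductive foformula : Type :=
| FoEq n (s t : foterm n)
| FoFalse
| FoImp (phi psi : foformula)
| FoForall (p : fovar) (phi : foformula).

Fixpoint foterm_vars n (t : foterm n) : seq fovar :=
  match t with
  | FoVar p => [:: p]
  | FoIncl _ t => foterm_vars t
  | FoMul _ _ s t => foterm_vars s ++ foterm_vars t
  end.

Fixpoint free_vars (phi : foformula) : seq fovar :=
  match phi with
  | FoEq _ s t => foterm_vars s ++ foterm_vars t
  | FoFalse => [::]
  | FoImp phi psi => free_vars phi ++ free_vars psi
  | FoForall p phi => [seq q <- free_vars phi | q != p]
  end.

Section Semantics.
Variables (G : groupType) (L : set G).

Definition valuation := forall p : fovar, expset L p.1.

(** Terms are evaluated in [G], where the inclusion maps of sorts become the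
    identity; [foterm_eval_sort] shows that a term of sort [n] takes its value
    in sort [n]. *)
Fixpoint foterm_eval (v : valuation) n (t : foterm n) : G :=
  match t with
  | FoVar p => val (v p)
  | FoIncl _ t => foterm_eval v t
  | FoMul _ _ s t => foterm_eval v s * foterm_eval v t
  end.

Lemma foterm_eval_sort (L1 : L 1) v n (t : foterm n) :
  expset L n (foterm_eval v t).
Proof.
elim: t => [p|m t IHt|m k s IHs t IHt]; first exact: set_mem (valP (v p)).
  by rewrite expsetS; exists 1 => //; exists (foterm_eval v t); rewrite ?mul1g.
exact: expsetD.
Qed.

(** [dfwith v p a] is [v] with the value at the variable [p] changed to [a]. *)
Fixpoint holds (v : valuation) (phi : foformula) : Prop :=
  match phi with
  | FoEq _ s t => foterm_eval v s = foterm_eval v t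
  | FoFalse => False
  | FoImp phi psi => holds v phi -> holds v psi
  | FoForall p phi => forall a : expset L p.1, holds (dfwith v p a) phi
  end.

(** The variable [(k, 0)] runs over the k-th power of [L]; the other free
    variables are of sort 1, so their values are parameters in [L]. *)
Definition definable_subset (k : nat) (D : set G) :=
  exists (phi : foformula) (v : valuation),
    (forall p, p \in free_vars phi -> p != (k, 0) -> p.1 = 1%N) /\
    D = [set val a | a in
          [set a : expset L k | holds (dfwith v (k, 0) a) phi]].

End Semantics.

(* Main.v *)
Require Import Defs.
From HB Require Import structures.
From mathcomp Require Import all_boot all_order all_algebra finmap.
From mathcomp Require Import all_classical.
From mathcomp Require Import interval_inference reals topology urysohn.
From mathcomp Require Import num_normedtype normed_module Rstruct lra.

(** Write [X n] for the n-th power of [L].  Ultrafilters on [G] containing some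
    [X n] form a semigroup [S] for (p q)(A) = p {g | q {h | A (g h)}}.  For an
    idempotent [u] of a minimal left ideal, [E = u S u] is a group; in the tau
    topology of Ellis and Glasner its right translations and inversion are
    continuous, and it is covered by the interiors of countably many compact
    sets.  The intersection of the closed neighbourhoods of 1 is a normal
    subgroup with Hausdorff quotient, a topological group by Ellis' joint
    continuity theorem; dividing further by a small compact normal subgroup
    (Kakutani-Kodaira) makes it second countable.  This is [H], and [f g] is
    the class of [u g u].

    If [v] is idempotent then [v] contains [g^-1 (X 2) g] for every [g].  Hence
    [s u] and [s v] differ on the left by an ultrafilter containing [X 6],
    uniformly in [s], and the errors of [f], as well as all their conjugates,
    contain [X 6].  [Sh] is the closure of the set of elements of [E] with this
    property.  Likewise, limits of [f] along two ultrafilters that agree on the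
    definable sets {g | k g k'^-1 in L} differ by an element of [Sh], which
    yields the definable separation by compactness. *)

Set Implicit Arguments.
Unset Strict Implicit.
Unset Printing Implicit Defensive.

Local Open Scope classical_set_scope.
Local Open Scope group_scope.

(** * Group topologies and quotients *)

(** Multiplication is only asked to be continuous on one side, which is what the tau topology
    provides; left translations follow by conjugating right ones with inversion. *)
Record group_topology (G : groupType) := GroupTopology {
  gt_open : set (set G) ;
  gt_openT : gt_open [set: G] ;
  gt_openI : setI_closed gt_open ;
  gt_open_bigU : forall (I : Type) (f : I -> set G),
    (forall i, gt_open (f i)) -> gt_open (\bigcup_i f i) ;
  gt_openMr : forall a A, gt_open A -> gt_open [set x | A (x * a)] ;
  gt_openV : forall A, gt_open A -> gt_open [set x | A x^-1]
}.

Definition topologized (G : groupType) (t : group_topology G) : Type := G.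

HB.instance Definition _ (G : groupType) (t : group_topology G) :=
  Group.on (topologized t).

HB.instance Definition _ (G : groupType) (t : group_topology G) :=
  isOpenTopological.Build (topologized t)
    (gt_openT t) (@gt_openI _ t) (@gt_open_bigU _ t).

Section GroupTopology.
Context {G : groupType} {t : group_topology G}.
Local Notation T := (topologized t).
Implicit Types (x y a : T) (A B : set T).

Lemma continuous_mulr a : continuous (fun x : T => x * a).
Proof. by apply/continuousP => A; exact: gt_openMr. Qed.

Lemma continuous_invg : continuous (fun x : T => x^-1).
Proof. by apply/continuousP => A; exact: gt_openV. Qed.

Lemma open_mulr a A : open A -> open [set x | A (x * a)].
Proof. exact: gt_openMr. Qed.

Lemma open_invg A : open A -> open [set x | A x^-1].
Proof. exact: gt_openV. Qed.

Lemma open_mull a A : open A -> open [set x | A (a * x)].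
Proof.
move=> /open_invg/(@open_mulr a^-1)/open_invg.
by congr open; apply/seteqP; split => x /=; rewrite invgM !invgK.
Qed.

Lemma continuous_mull a : continuous (fun x : T => a * x).
Proof. by apply/continuousP => A; exact: open_mull. Qed.

Lemma nbhs_mull a x A : nbhs (a * x) A -> nbhs x [set y | A (a * y)].
Proof. exact: continuous_mull. Qed.

Lemma nbhs_mulr a x A : nbhs (x * a) A -> nbhs x [set y | A (y * a)].
Proof. exact: continuous_mulr. Qed.

Lemma nbhs_invg x A : nbhs x^-1 A -> nbhs x [set y | A y^-1].
Proof. exact: continuous_invg. Qed.

End GroupTopology.

Record normal_subgroup (G : groupType) := NormalSubgroup {
  ns_set :> G -> Prop ;
  ns_subgroup : is_subgroup ns_set ;
  ns_normal : normal_subset ns_set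
}.

Section NormalSubgroup.
Context {G : groupType} (N : normal_subgroup G).
Implicit Types x y : G.

Lemma ns1 : N 1. Proof. exact: (ns_subgroup N).1. Qed.

Lemma nsV x : N x -> N x^-1.
Proof. by move=> Nx; rewrite -[x^-1]mul1g; exact: (ns_subgroup N).2 ns1 Nx. Qed.

Lemma nsM x y : N x -> N y -> N (x * y).
Proof. by move=> Nx /nsV Ny; rewrite -[y]invgK; exact: (ns_subgroup N).2. Qed.

Lemma nsJ x y : N x -> N (x ^ y). Proof. exact: ns_normal. Qed.

(** [xget] sees the whole coset as a set, so its choice depends on the coset alone. *)
Definition coset_repr x := xget 1 [set y | N (x^-1 * y)].

Lemma coset_reprP x : N (x^-1 * coset_repr x).
Proof.
have : [set y | N (x^-1 * y)] x by rewrite /= mulVg; exact: ns1.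
by move=> h; exact: (@xgetPex _ 1 _ (ex_intro _ x h)).
Qed.

Lemma eq_coset_repr x y : N (x^-1 * y) -> coset_repr x = coset_repr y.
Proof.
move=> Nxy; congr (xget _ _); apply/seteqP; split => z /= Nz.
  have -> : y^-1 * z = (x^-1 * y)^-1 * (x^-1 * z).
    by rewrite invgM invgK mulgA -(mulgA _ x) mulgV mulg1.
  by apply: nsM => //; exact: nsV.
have -> : x^-1 * z = (x^-1 * y) * (y^-1 * z).
  by rewrite mulgA -(mulgA _ y) mulgV mulg1.
exact: nsM.
Qed.

Lemma coset_reprK x : coset_repr (coset_repr x) = coset_repr x.
Proof. by apply/esym/eq_coset_repr/coset_reprP. Qed.

Definition quot := {x : G | coset_repr x == x}.

HB.instance Definition _ := Choice.on quot.

Definition qpi x : quot := exist _ (coset_repr x) (introT eqP (coset_reprK x)).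

Lemma qpi_eq x y : qpi x = qpi y <-> N (x^-1 * y).
Proof.
split=> [/(congr1 val) /= e|/eq_coset_repr e]; last exact: val_inj.
have -> : x^-1 * y = (x^-1 * coset_repr x) * (y^-1 * coset_repr y)^-1.
  by rewrite e invgM invgK mulgA -(mulgA _ (coset_repr y)) mulgV mulg1.
by apply: nsM; [|apply: nsV]; exact: coset_reprP.
Qed.

Lemma valqK (x : quot) : qpi (val x) = x.
Proof. by apply: val_inj => /=; apply/eqP/(valP x). Qed.

Definition quot_mul (x y : quot) := qpi (val x * val y).
Definition quot_inv (x : quot) := qpi (val x)^-1.

Lemma quot_mulE x y : quot_mul (qpi x) (qpi y) = qpi (x * y).
Proof.
apply/esym/qpi_eq => /=.
have Nx := coset_reprP x; have Ny := coset_reprP y.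
have -> : (x * y)^-1 * (coset_repr x * coset_repr y) =
  ((x^-1 * coset_repr x) ^ y) * (y^-1 * coset_repr y).
  by rewrite conjgE invgM !mulgA mulgK.
by apply: nsM => //; exact: nsJ.
Qed.

Lemma quot_invE x : quot_inv (qpi x) = qpi x^-1.
Proof.
apply/esym/qpi_eq => /=.
have -> : x^-1^-1 * (coset_repr x)^-1 =
    ((x^-1 * coset_repr x)^-1) ^ x^-1.
  by rewrite conjgE !invgM !invgK !mulgA mulgK.
by apply/nsJ/nsV/coset_reprP.
Qed.

Lemma quot_mulA : associative quot_mul.
Proof.
move=> x y z; rewrite -(valqK x) -(valqK y) -(valqK z).
by rewrite !quot_mulE mulgA.
Qed.

Lemma quot_mul1 : left_id (qpi 1) quot_mul.
Proof. by move=> x; rewrite -(valqK x) quot_mulE mul1g. Qed.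

Lemma quot_mul1r : right_id (qpi 1) quot_mul.
Proof. by move=> x; rewrite -(valqK x) quot_mulE mulg1. Qed.

Lemma quot_mulV : left_inverse (qpi 1) quot_inv quot_mul.
Proof. by move=> x; rewrite -(valqK x) quot_invE quot_mulE mulVg. Qed.

Lemma quot_mulVr : right_inverse (qpi 1) quot_inv quot_mul.
Proof. by move=> x; rewrite -(valqK x) quot_invE quot_mulE mulgV. Qed.

HB.instance Definition _ := isGroup.Build quot
  quot_mulA quot_mul1 quot_mul1r quot_mulV quot_mulVr.

Lemma qpiM x y : qpi (x * y) = qpi x * qpi y. Proof. by rewrite -quot_mulE. Qed.
Lemma qpiV x : qpi x^-1 = (qpi x)^-1. Proof. by rewrite -quot_invE. Qed.
End NormalSubgroup.

Section QuotientTopology.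
Context {G : groupType} (t : group_topology G) (N : normal_subgroup G).
Local Notation T := (topologized t).

Definition quot_open : set (set (quot N)) :=
  [set A | @open T (qpi N @^-1` A)].

Lemma quot_openMr (a : quot N) A : quot_open A -> quot_open [set x | A (x * a)].
Proof.
move=> /(@open_mulr _ t (val a)); congr open; apply/seteqP.
by split => x /=; rewrite /= qpiM valqK.
Qed.

Lemma quot_openV A : quot_open A -> quot_open [set x | A x^-1].
Proof.
move=> /(@open_invg _ t); congr open; apply/seteqP.
by split => x /=; rewrite qpiV.
Qed.

Definition quot_topology : group_topology (quot N) :=
  @GroupTopology (quot N) quot_open (@openT T)
    (fun A B oA oB => openI oA oB)
    (fun I f of_ => @bigcup_open T I setT _ (fun i _ => of_ i))
    quot_openMr quot_openV.

Local Notation Q := (topologized quot_topology).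

Lemma qpi_continuous : continuous (qpi N : T -> Q).
Proof. by apply/continuousP. Qed.

(** The saturation of [A] under [N] is a union of right translates of [A]. *)
Lemma qpi_open (A : set T) : open A -> open (qpi N @` A : set Q).
Proof.
move=> oA; have : @open T (\bigcup_(n in ns_set N) [set x | A (x * n)]).
  by apply: bigcup_open => n _; exact: open_mulr.
congr open; apply/seteqP; split => x /=.
  move=> [n Nn /= Axn]; exists (x * n) => //; apply/qpi_eq.
  by rewrite invgM mulgVK; exact: nsV.
move=> [y Ay /esym/qpi_eq Nxy]; exists (x^-1 * y) => //=.
by rewrite mulgA mulgV mul1g.
Qed.

Lemma qpi_nbhs (x : T) (A : set T) :
  nbhs x A -> nbhs (qpi N x : Q) (qpi N @` A).
Proof.
rewrite !nbhsE => -[B [oB Bx] BA].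
exists (qpi N @` B); last exact: image_subset.
by split; [exact: qpi_open | exists x].
Qed.

Lemma qpi_compact (K : set T) : compact K -> compact (qpi N @` K : set Q).
Proof.
apply: continuous_compact; apply: continuous_subspaceT.
exact: qpi_continuous.
Qed.

End QuotientTopology.

Section SeparatedQuotient.
Context {G : groupType} (t : group_topology G).
Local Notation T := (topologized t).

Definition inseparables : set T := \bigcap_(V in nbhs (1 : T)) closure V.

(** For [y] in [V], the translate [y^-1 V] is a neighbourhood of 1, so [n] lies in its closure and
    [y * n] in that of [V]. Right translation by [n] carries this over to limits of such [y]; joint
    continuity is not involved. *)
Lemma closure_mul_inseparable (V : set T) (x n : T) :
  open V -> inseparables n -> closure V x -> closure V (x * n).
Proof.
move=> oV Nn; have key y B : V y -> nbhs (y * n) B -> V `&` B !=set0.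
  move=> Vy nB; have nV : nbhs (1 : T) [set z | V (y * z)].
    by apply: nbhs_mull; rewrite mulg1; exact: open_nbhs_nbhs.
  by have [z []] := Nn _ nV _ (nbhs_mull nB); exists (y * z).
move=> clx B /nbhs_interior/nbhs_mulr/clx[y [Vy By]].
exact: key Vy By.
Qed.

Lemma inseparables_subgroup : is_subgroup (inseparables : set G).
Proof.
split=> [V /nbhs_singleton V1|x y Nx Ny]; first exact: subset_closure.
have NV : inseparables y^-1.
  move=> V; rewrite -[X in nbhs X](@invg1 G) => /nbhs_invg nV B nB.
  have [z [Vz Bz]] := Ny _ nV _ (nbhs_invg nB).
  by exists z^-1.
move=> V nV; apply: (closureS (@interior_subset _ V)).
apply: closure_mul_inseparable => //; first exact: open_interior.
by apply: Nx; exact: nbhs_interior.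
Qed.

Lemma inseparables_normal : normal_subset (inseparables : set G).
Proof.
move=> x y Nx V nV B nB.
have n1 : nbhs (1 : T) [set z | V (y^-1 * (z * y))].
  apply: (@nbhs_mulr _ t y 1 [set w | V (y^-1 * w)]); apply: nbhs_mull.
  by rewrite mul1g mulVg.
have nx : nbhs (x : T) [set z | B (y^-1 * (z * y))].
  by apply: (@nbhs_mulr _ t y x [set w | B (y^-1 * w)]); apply: nbhs_mull.
by have [z [Vz Bz]] := Nx _ n1 _ nx; exists (y^-1 * (z * y)).
Qed.

Definition inseparable_group : normal_subgroup G :=
  NormalSubgroup inseparables_subgroup inseparables_normal.

Local Notation Q := (topologized (quot_topology t inseparable_group)).

(** If the images of [x V] and [x B] meet, then [B] contains a point of [V] times an inseparable
    element, hence a point of the closure of [V]; so [V] and [B] meet. *)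
Lemma hausdorff_separated : hausdorff_space Q.
Proof.
move=> p q; rewrite -[p]valqK -[q]valqK; set x : T := val p; set y : T := val q.
move=> clpq; apply/qpi_eq => V nV B nB; apply: contrapT => VB0.
have nx : nbhs x [set z | V° (x^-1 * z)].
  by apply: nbhs_mull; rewrite mulVg; exact: nbhs_interior.
have ny : nbhs y [set z | B° (x^-1 * z)].
  by apply: nbhs_mull; exact: nbhs_interior.
have [_ [[v Vv <-] [w Bw /esym/qpi_eq Nvw]]] :=
  clpq _ _ (qpi_nbhs _ nx) (qpi_nbhs _ ny).
have : closure V° (x^-1 * w).
  have -> : x^-1 * w = x^-1 * v * (v^-1 * w) by rewrite -mulgA mulVKg.
  apply: closure_mul_inseparable => //; first exact: open_interior.
  exact: subset_closure.
move=> /(_ _ Bw)[z [/interior_subset Vz Bz]].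
by apply: VB0; exists z.
Qed.

End SeparatedQuotient.

Lemma locally_compact_nbhs (X : topologicalType) : hausdorff_space X ->
  (forall x : X, exists2 K, compact K & nbhs x K) -> locally_compact [set: X].
Proof.
move=> hX lX x _; have [K cK nK] := lX x.
rewrite withinET; exists K => //; split=> //.
exact: compact_closed.
Qed.

(** * Ellis' joint continuity theorem *)

Lemma ultra_fmap (X Y : Type) (f : X -> Y) (F : set_system X) :
  UltraFilter F -> UltraFilter (f @ F).
Proof.
move=> UF; split=> [|H PH FH]; first exact: fmap_proper_filter.
apply/seteqP; split=> // A HA.
have [//|nA] := in_ultra_setVsetC (f @^-1` A) UF.
have : H (A `&` ~` A) by apply: filterI => //; apply: FH.
by rewrite setICr => /filter_not_empty.
Qed.

Lemma compact_ultra_lim (X : topologicalType) (K : set X) (Y : Type)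
    (F : set_system Y) (f : Y -> X) : compact K -> UltraFilter F ->
  F (f @^-1` K) -> exists2 p, K p & f @ F --> p.
Proof.
rewrite compact_ultra => cK UF FK.
by have [p [Kp fp]] := cK _ (ultra_fmap f UF) FK; exists p.
Qed.

Section Ellis.
Import Order.TTheory GRing.Theory Num.Theory numFieldNormedType.Exports.
Context {G : groupType} (t : group_topology G).
Local Notation T := (topologized t).
Variable R : realType.
Hypothesis hT : hausdorff_space T.
Hypothesis lT : locally_compact [set: T].

Local Notation eps n := ((n.+1%:R : R)^-1)%R.

(* Joint continuity of multiplication at 1.  If it fails for [O], choose
   sequences [a], [y] in a compact neighbourhood of 1 with
   psi (a m * y n) > 1/2 for n < m, and psi (a i * y n) smaller than
   psi (a i / a n) + eps n for i <= n, where psi 1 = 0 and psi = 1 off [O].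
   Let [p], [q^-1] be their limits along an ultrafilter on the integers: taking
   the limits in both orders gives psi (p / q) >= 1/2, resp.
   psi (p / q) <= psi (p / p) = 0. *)
Record ellis_state (K : set T) := EllisState {
  es_pt : T; es_nb : set T; es_seq : seq T;
  es_nbP : open_nbhs es_pt es_nb;
  es_sub : es_nb `<=` K }.

Definition ellis_cond (psi : T -> R) (K : set T) (s s' : ellis_state K) y :=
  [/\ K y^-1, forall x, es_nb s' x -> (1/2 < psi (x * y)%g)%R &
     forall d, d \in (es_pt s :: es_seq s) ->
       (psi (d * y)%g < psi (d / es_pt s)%g + eps (size (es_seq s)))%R].

Lemma nbhs1_mulg (O : set T) : nbhs (1 : T) O ->
  exists2 V, nbhs (1 : T) V & forall v w, V v -> V w -> O (v * w).
Proof.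
move=> nO; apply: contrapT => nV.
have cr := @locally_compact_completely_regular T R lT hT.
have cO : closed (~` O°) by apply/open_closedC/open_interior.
have [|psi [cpsi _ psi0 psi1]] :=
    (uniform_separatorP (R := R) _ _).1 (cr 1 _ cO _).
  by apply; exact: nO.
have {}psi0 : psi 1 = 0%R by apply: psi0; exists 1.
have {}psi1 x : ~ O x -> psi x = 1%R.
  by move=> nOx; apply: psi1; exists x => // /interior_subset.
have [K nK [cK clK]] : exists2 K, nbhs (1 : T) K & compact K /\ closed K.
  by have := @lT (1 : T) I; rewrite withinET => -[K nK cK]; exists K.
(* The failure at 1 is moved to the pair [a], [a^-1]: [U a^-1] and [a V] are neighbourhoods of 1,
   and inserting [a^-1 * a] leaves the product unchanged. *)
have bad (a : T) (U V : set T) : nbhs a U -> nbhs (a^-1) V ->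
    exists x y : T, [/\ U x, V y & psi (x * y) = 1%R].
  move=> nU nVa; apply: contrapT => h; apply: nV.
  exists ([set v | U (v * a)] `&` [set w | V (a^-1 * w)]).
    by apply: filterI; [apply: nbhs_mulr; rewrite mul1g|
      apply: nbhs_mull; rewrite mulg1].
  move=> v w [Uv _] [_ Vw]; apply: contrapT => nOvw; apply: h.
  exists (v * a), (a^-1 * w); split=> //; apply: psi1.
  by rewrite mulgA mulgK.
have K1 : open_nbhs (1 : T) K° by split; [exact: open_interior|].
pose s0 := @EllisState K 1 K° [::] K1 (@interior_subset _ K).
(* All later points are taken in the current neighbourhood, so the lower bound on [psi (x * y)]
   persists. The upper bounds hold because [y] is chosen close to [a^-1]. *)
have step (s : ellis_state K) : exists s' : ellis_state K,
    [/\ es_nb s' `<=` es_nb s, es_seq s' = es_pt s :: es_seq s &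
        exists y, ellis_cond psi s s' y].
  case: s => a U D [oU Ua] UK /=.
  pose V := [set y | U y^-1 /\ forall d, d \in a :: D ->
    (psi (d * y)%g < psi (d / a)%g + eps (size D))%R].
  have nV' : nbhs (a^-1) V.
    apply: filterI.
      by apply: nbhs_invg; rewrite invgK; exact: open_nbhs_nbhs.
    elim: {V} (a :: D) => [|d D' IH]; first exact: filterE.
    have nd : nbhs (a^-1)
        [set y | (psi (d * y)%g < psi (d / a)%g + eps (size D))%R].
      apply: (@nbhs_mull _ t d _
        [set z | (psi z < psi (d / a)%g + eps (size D))%R]).
      apply: (cpsi (d / a) [set r | (r < psi (d / a)%g + eps (size D))%R]).
      apply: open_nbhs_nbhs; split; first exact: open_lt.
      by rewrite /= ltrDl invr_gt0 ltr0n.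
    apply: filterS (filterI nd IH) => y [h1 h2] e.
    by rewrite inE => /predU1P[->|/h2].
  have [x [y [Ux [Uy yP] xy1]]] := bad a U V (open_nbhs_nbhs (conj oU Ua)) nV'.
  pose U' := U `&` [set x | (1/2 < psi (x * y)%g)%R].
  have oU' : open_nbhs x U'.
    split; last by split=> //=; rewrite xy1; lra.
    apply: openI => //; apply: (@open_mulr _ t y [set z | (1/2 < psi z)%R]).
    move/continuousP: cpsi => /(_ [set r | (1/2 < r)%R]); apply.
    exact: open_gt.
  have U'K : U' `<=` K by move=> z [/UK].
  exists (@EllisState K x U' (a :: D) oU' U'K); split=> [z []||] //.
  by exists y; split=> [|z [_ /=]|] //; exact: UK.
have [s [s00 sS]] := dependent_choice (fun s => cid (step s)) s0.
have mono n m : (n <= m)%N -> es_nb (s m) `<=` es_nb (s n).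
  elim: m => [|m IH]; first by rewrite leqn0 => /eqP->.
  rewrite leq_eqVlt => /predU1P[->//|/IH]; apply: subset_trans.
  by have [] := sS m.
have sz n : size (es_seq (s n)) = n.
  by elim: n => [|n IH]; [rewrite s00|have [_ -> _] := sS n; rewrite /= IH].
have mem i n : (i <= n)%N -> es_pt (s i) \in es_pt (s n) :: es_seq (s n).
  elim: n => [|n IH]; first by rewrite leqn0 => /eqP->; rewrite mem_head.
  rewrite leq_eqVlt => /predU1P[->|/IH]; first by rewrite mem_head.
  by have [_ -> _] := sS n; rewrite !inE => ->; rewrite orbT.
have /choice[y yP] : forall n, exists y, ellis_cond psi (s n) (s n.+1) y.
  by move=> n; have [_ _] := sS n.
pose a n := es_pt (s n).
have aK n : K (a n) by apply: (es_sub (e := s n)); exact: (es_nbP _).2.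
have [w [uw winf]] := ultraFilterLemma (@eventually_filter).
have [p Kp ap] : exists2 p, K p & a @ w --> p.
  by apply: compact_ultra_lim => //; exact: filterE.
have [q Kq yq] : exists2 q, K q & (fun n => (y n)^-1) @ w --> q.
  by apply: compact_ultra_lim => //; apply: filterE => n; have [] := yP n.
have {}yq : y @ w --> q^-1.
  have -> : y = (fun n => (y n)^-1^-1) by apply/funext => n; rewrite invgK.
  exact: (cvg_comp _ (fun z : T => z^-1) yq (@continuous_invg _ t _)).
have Vap : (fun n => (a n)^-1) @ w --> p^-1.
  exact: (cvg_comp _ (fun z : T => z^-1) ap (@continuous_invg _ t _)).
have below (f : T -> R) (g : nat -> T) l c : continuous f -> g @ w --> l ->
    (f l < c)%R -> w [set n | (f (g n) < c)%R].
  move=> cf gl flc; apply: (gl [set z | (f z < c)%R]).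
  apply: (cf l [set r | (r < c)%R]).
  by apply: open_nbhs_nbhs; split; first exact: open_lt.
have above (f : T -> R) (g : nat -> T) l c : continuous f -> g @ w --> l ->
    (c < f l)%R -> w [set n | (c < f (g n))%R].
  move=> cf gl flc; apply: (gl [set z | (c < f z)%R]).
  apply: (cf l [set r | (c < r)%R]).
  by apply: open_nbhs_nbhs; split; first exact: open_gt.
have cl (x : T) : continuous (fun z : T => psi (x * z)).
  move=> z; apply: (cvg_comp _ psi (@continuous_mull _ t x z)); exact: cpsi.
have cr' (x : T) : continuous (fun z : T => psi (z * x)).
  move=> z; apply: (cvg_comp _ psi (@continuous_mulr _ t x z)); exact: cpsi.
(* Each iterated limit becomes two choices of an index. Here [i] is fixed before [n >= i], and the
   bounds 1/8 + 1/8 contradict 1/4; in the other case [n] is fixed before [m > n]. *)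
have [ge|lt] := leP (1/2)%R (psi (p / q)).
  have /filter_ex[i [/= qi pi]] : w ([set i | (1/4 < psi (a i / q)%g)%R] `&`
      [set i | (psi (a i / p)%g < 1/8)%R]).
    apply: filterI.
      by apply: (above (fun z => psi (z / q)) a p) => //; lra.
    by apply: (below (fun z => psi (z / p)) a p) => //; rewrite mulgV psi0; lra.
  have /filter_ex[n [[/= n1 n2] [/= n3 n4]]] :
    w (([set n | (1/4 < psi (a i * y n)%g)%R] `&`
       [set n | (psi (a i / a n)%g < 1/8)%R]) `&`
       ([set n | (i <= n)%N] `&` [set n | (eps n < 1/8)%R])).
    apply: filterI; apply: filterI.
    - exact: (above (fun z => psi (a i * z)) y (q^-1)).
    - exact: (below (fun z => psi (a i * z)) (fun n => (a n)^-1) (p^-1)).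
    - by apply: winf; exact: nbhs_infty_ge.
    - have e8 : (0 < 1 / 8 :> R)%R by lra.
      by apply: winf; exact: (near_infty_natSinv_lt (PosNum e8)).
  have [_ _ /(_ _ (mem _ _ n3))] := yP n.
  rewrite sz -/(a i) -/(a n) => n5.
  by have := lt_trans (lt_trans n1 n5) (ltrD n2 n4); lra.
have /filter_ex[n /= n1] : w [set n | (psi (p * y n)%g < 1/2)%R].
  exact: (below (fun z => psi (p * z)) y (q^-1)).
have /filter_ex[m [/= m1 m2]] :
    w ([set m | (psi (a m * y n)%g < 1/2)%R] `&` [set m | (n < m)%N]).
  apply: filterI; first exact: (below (fun z => psi (z * y n)) a p).
  by apply: winf; exact: nbhs_infty_ge.
have [_ /(_ (a m)) + _] := yP n.
suff : es_nb (s n.+1) (a m) by move=> h /(_ h); lra.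
by apply: (mono _ _ m2); exact: (es_nbP _).2.
Qed.

(** Continuity at 1 suffices, since [z * z' = x * ((x^-1 * z) * (z' / y)) * y] and one-sided
    translations are continuous. *)
Lemma ellis_continuous_mulg : continuous (fun xy : T * T => xy.1 * xy.2).
Proof.
move=> [x y] /= A nA.
have nO : nbhs (1 : T) [set z | A (x * (z * y))].
  apply: (@nbhs_mulr _ t y 1 [set z | A (x * z)]); rewrite mul1g.
  exact: nbhs_mull.
have [V nV VO] := nbhs1_mulg nO.
exists ([set z | V (x^-1 * z)], [set z | V (z / y)]).
  split=> /=; first by apply: nbhs_mull; rewrite mulVg.
  by apply: (@nbhs_mulr _ t y^-1); rewrite mulgV.
move=> [z z'] /= [Vz Vz']; have /= := VO _ _ Vz Vz'.
by rewrite -!mulgA mulVKg mulVg mulg1.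
Qed.

End Ellis.

(** * Second countable quotients *)

HB.instance Definition _ (G : groupType) (t : group_topology G) :=
  isPointed.Build (topologized t) (1 : G).

Section KakutaniKodaira.
Context {G : groupType} (t : group_topology G).
Local Notation T := (topologized t).
Hypothesis mulC : continuous (fun xy : T * T => xy.1 * xy.2).

Lemma cvg_mulg (X : Type) (F : set_system X) (f g : X -> T) (a b : T) :
  Filter F -> f @ F --> a -> g @ F --> b -> (fun x => f x * g x) @ F --> a * b.
Proof.
move=> FF fa gb.
exact: (@continuous2_cvg _ _ _ _ F FF f g (fun x y : T => x * y) a b
  (@mulC (a, b))).
Qed.

Lemma nbhs_div (U : set T) : nbhs (1 : T) U ->
  exists2 V, nbhs (1 : T) V & forall x y, V x -> V y -> U (x / y).
Proof.
move=> nU.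
have c : (fun xy : T * T => xy.1 / xy.2) @ nbhs ((1 : T), (1 : T)) -->
    (1 / 1 : T).
  apply: cvg_mulg; first exact: cvg_fst.
  exact: (cvg_comp _ (fun z : T => z^-1) cvg_snd (@continuous_invg _ t 1)).
rewrite divg1 in c; have [[A B] /= [nA nB] AB] := c _ nU.
exists (A `&` B); first exact: filterI.
by move=> x y [Ax _] [_ By]; exact: (AB (x, y)).
Qed.

(** Conjugation is continuous at each pair [(x, 1)]; compactness, in its near-covering form, makes
    the neighbourhood of 1 uniform in [x]. *)
Lemma nbhs_conj_compact (K U : set T) : compact K -> nbhs (1 : T) U ->
  exists2 V, nbhs (1 : T) V & forall v x, V v -> K x -> U (v ^ x).
Proof.
move=> /compact_near_coveringP cK nU.
exists [set v | K `<=` (fun x => U (v ^ x))]; last by move=> v x /=; exact.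
apply: (cK T (nbhs (1 : T)) (fun v x => U (v ^ x))) => x Kx.
have c : (fun xv : T * T => xv.2 ^ xv.1) @ nbhs ((x : T), (1 : T)) -->
    (1 ^ x : T).
  apply: cvg_mulg.
    exact: (cvg_comp _ (fun z : T => z^-1) cvg_fst (@continuous_invg _ t x)).
  by apply: cvg_mulg; [exact: cvg_snd|exact: cvg_fst].
by rewrite conj1g in c; exact: c _ nU.
Qed.

Lemma quot_mul_continuous (N : normal_subgroup G) :
  let Q := topologized (quot_topology t N) in
  continuous (fun xy : Q * Q => xy.1 * xy.2).
Proof.
move=> Q [p q] A /=; rewrite -[p]valqK -[q]valqK.
set x : T := val p; set y : T := val q; rewrite -qpiM => nA.
have nA' : nbhs (x * y) (qpi N @^-1` A) by apply: qpi_continuous.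
have [[V W] /= [nV nW] VW] := @mulC (x, y) _ nA'.
exists (qpi N @` V, qpi N @` W); first by split; exact: qpi_nbhs.
move=> [_ _] /= [[v Vv <-] [w Ww <-]]; rewrite -qpiM.
exact: (VW (v, w)).
Qed.

Section Sequence.
Variable K : nat -> set T.
Hypothesis cK : forall n, compact (K n).
Hypothesis mK : forall n m, (n <= m)%N -> K n `<=` K m.
Hypothesis nK : forall x : T, exists n, nbhs x (K n).

Variable U : nat -> set T.
Hypothesis nU : forall n, nbhs (1 : T) (U n).
Hypothesis divU : forall n (x y : T), U n.+1 x -> U n.+1 y -> U n (x / y).
Hypothesis conjU : forall n (v x : T), U n.+1 v -> K n x -> U n (v ^ x).
Hypothesis KU : exists n, U 0 `<=` K n.

Let U1 n : U n 1. Proof. exact: nbhs_singleton. Qed.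

Let subU n m : (n <= m)%N -> U m `<=` U n.
Proof.
elim: m => [|m IH]; first by rewrite leqn0 => /eqP->.
rewrite leq_eqVlt => /predU1P[->//|/IH]; apply: subset_trans => x Ux.
by rewrite -[x]divg1; exact: divU.
Qed.

Lemma kernel_subgroup : is_subgroup (\bigcap_n U n : set G).
Proof.
split=> [n _ //|x y Nx Ny n _]; apply: divU; [exact: Nx|exact: Ny].
Qed.

Lemma kernel_normal : normal_subset (\bigcap_n U n : set G).
Proof.
move=> x y Nx n _; have [j /nbhs_singleton Kj] := nK y.
apply: (subU (leq_maxl n j)); apply: conjU; first exact: Nx.
exact: mK (leq_maxr n j) _ Kj.
Qed.

(** The normal subgroup of Kakutani and Kodaira. The sets [U n] shrink to it, so their images form a
    base at 1 of the quotient. *)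
Definition kernel : normal_subgroup G :=
  NormalSubgroup kernel_subgroup kernel_normal.

Local Notation Q := (topologized (quot_topology t kernel)).

Lemma kernel_hausdorff : hausdorff_space Q.
Proof.
move=> p q; rewrite -[p]valqK -[q]valqK; set x : T := val p; set y : T := val q.
move=> clpq; apply/qpi_eq => n _.
(* The index is [n.+2] because [x^-1 * y] is recovered below by two nested divisions. *)
have nx (z : T) : nbhs z [set w | U n.+2 (z^-1 * w)].
  by apply: nbhs_mull; rewrite mulVg.
have [_ [[v Uv <-] [w Uw /esym/qpi_eq Nvw]]] :=
  clpq _ _ (qpi_nbhs _ (nx x)) (qpi_nbhs _ (nx y)).
have -> : x^-1 * y = (x^-1 * v) / ((y^-1 * w) / (v^-1 * w)).
  by rewrite !invgM !invgK -!mulgA !mulVKg.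
apply: divU; first exact: subU Uv.
by apply: divU => //; exact: Nvw.
Qed.

(** Otherwise points of [U n] outside [P] accumulate at some [p], by compactness. As [p] is a
    quotient of two elements of [U n.+1] for every [n], it lies in the kernel, hence in [P], which
    is a contradiction. *)
Lemma kernel_nbhs (P : set T) : open P -> kernel `<=` P -> exists n, U n `<=` P.
Proof.
move=> oP NP; apply: contrapT => /forallNP h.
have /choice[x xP] : forall n, exists x, U n x /\ ~ P x.
  by move=> n; have /existsNP[x /not_implyP] := h n; exists x.
have [w [uw winf]] := ultraFilterLemma (@eventually_filter).
have [j UK] := KU.
have [p Kp xp] : exists2 p, K j p & x @ w --> p.
  apply: compact_ultra_lim => //; apply: filterE => n; apply: UK.
  by apply: (@subU 0 n) => //; exact: (xP n).1.
have Np : kernel p.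
  move=> n _; have nn : nbhs p [set z | U n.+1 (p^-1 * z)].
    by apply: nbhs_mull; rewrite mulVg.
  have /filter_ex[m [/= pm nm]] :
      w ((x @^-1` [set z | U n.+1 (p^-1 * z)]) `&` [set m | (n.+1 <= m)%N]).
    by apply: filterI; [exact: xp|apply: winf; exact: nbhs_infty_ge].
  have -> : p = x m / (p^-1 * x m) by rewrite invgM invgK mulVKg.
  by apply: divU => //; apply: (subU nm); exact: (xP m).1.
have nP : nbhs p P by apply: open_nbhs_nbhs; split=> //; exact: NP.
have /filter_ex[m /= Pm] : w (x @^-1` P) by exact: xp.
exact: (xP m).2.
Qed.

(** Each [K n] is covered by finitely many translates of the interior of each [U m]; the images of
    all these translates form a countable base. *)
Lemma kernel_second_countable : second_countable (T := Q).
Proof.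
have cov (mn : nat * nat) : exists D : {fset T},
    K mn.2 `<=` \bigcup_(d in [set` D]) [set z | (U mn.1)° (d^-1 * z)].
  have := @cK mn.2; rewrite compact_cover => /(_ T setT
    (fun d => [set z | (U mn.1)° (d^-1 * z)])).
  case=> [d _||D _ KD]; last by exists D.
    by apply: open_mull; exact: open_interior.
  by move=> x _; exists x => //=; rewrite mulVg; exact: nU.
have [D KD] := choice cov.
pose C := \bigcup_mn [set` D mn].
have cC : countable C.
  by apply: bigcup_countable => // mn _; apply: finite_set_countable.
pose b (dm : T * nat) : set Q :=
  qpi kernel @` [set z : T | (U dm.2)° (dm.1^-1 * z)].
exists (b @` (C `*` setT)).
  by apply: card_le_trans (card_image_le _ _) _; exact: countableX.
split.
  move=> _ [[d m] _ <-]; apply: qpi_open; apply: open_mull.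
  exact: open_interior.
move=> p; rewrite -[p]valqK; set x : T := val p => A /nbhs_interior nA.
have [n UP] : exists n, U n `<=` [set z : T | A° (qpi kernel (x * z))].
  apply: kernel_nbhs => [|k Nk /=].
    apply: (@open_mull _ t x [set z | A° (qpi kernel z)]).
    move/continuousP: (@qpi_continuous _ t kernel); apply.
    exact: open_interior.
  have -> : qpi kernel (x * k) = qpi kernel x.
    by apply/qpi_eq; rewrite invgM mulgVK; exact: nsV.
  exact: nbhs_singleton nA.
have [j /nbhs_singleton Kx] := nK x.
have [d Dd /= Ux] := KD (n.+2, j) _ Kx.
exists (b (d, n.+2)); last first.
  move=> _ [z /= /interior_subset Uz <-].
  apply: (@interior_subset _ A); have -> : z = x * (x^-1 * z) by rewrite mulVKg.
  (* Both [d^-1 * x] and [d^-1 * z] lie in [U n.+2]; inverting them costs one index and dividing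
     another. *)
  apply: UP; have -> : x^-1 * z = (d^-1 * x)^-1 / (d^-1 * z)^-1.
    by rewrite !invgM !invgK -mulgA mulVKg.
  by apply: divU; rewrite -[_^-1]div1g; apply: divU => //;
    exact: interior_subset.
split; last by exists x.
by exists (d, n.+2) => //; split => //; exists (n.+2, j).
Qed.

End Sequence.
End KakutaniKodaira.

(** Two quotients are composed: the separated one, where Ellis' theorem makes the multiplication
    jointly continuous, and the one by a kernel inside a prescribed neighbourhood. The last clause
    keeps the fibres of [pi] under control. *)
Theorem second_countable_quotient (G : groupType) (t : group_topology G)
    (K : nat -> set (topologized t)) (W : set (topologized t)) :
  (forall n, compact (K n)) -> (forall n m, (n <= m)%N -> K n `<=` K m) ->
  (forall x : topologized t, exists n, nbhs x (K n)) ->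
  nbhs (1 : topologized t) W ->
  exists (H : topologicalGroupType) (pi : topologized t -> H),
    [/\ second_countable (T := H), locally_compact [set: H]
      & hausdorff_space H] /\
    [/\ {morph pi : x y / x * y}, forall h, exists x, pi x = h, continuous pi,
        forall (x : topologized t) A, nbhs x A -> nbhs (pi x) (pi @` A)
      & exists2 P, nbhs (1 : H) P & pi @^-1` P `<=` closure W].
Proof.
move=> cK mK nK nW.
pose N0 := inseparable_group t; pose t1 := quot_topology t N0.
pose T1 := topologized t1; pose p1 : topologized t -> T1 := qpi N0.
have hT1 : hausdorff_space T1 by exact: hausdorff_separated.
pose K1 n : set T1 := p1 @` K n.
have cK1 n : compact (K1 n) by apply: qpi_compact; exact: cK.
have mK1 n m : (n <= m)%N -> K1 n `<=` K1 m.
  by move=> nm; apply: image_subset; exact: mK.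
have nK1 (x : T1) : exists n, nbhs x (K1 n).
  have [n nKn] := nK (val x); exists n; rewrite -[x]valqK; exact: qpi_nbhs.
have lT1 : locally_compact [set: T1].
  by apply: locally_compact_nbhs => // x; have [n nx] := nK1 x; exists (K1 n).
have mulC : continuous (fun xy : T1 * T1 => xy.1 * xy.2).
  exact: (ellis_continuous_mulg (Rdefinitions.R : realType) hT1 lT1).
have nW1 : nbhs (1 : T1) (p1 @` W°).
  by apply: (@qpi_nbhs _ t N0 1); exact: nbhs_interior.
have [V nV VW] := nbhs_div mulC nW1.
have [j nKj] := nK1 1.
pose U0 := V `&` K1 j.
have nU0 : nbhs (1 : T1) U0 by exact: filterI.
(* The hypothesis on [nU.2] sits under the existential, so that choice gives a total function that
   can be iterated. *)
have step (nU : nat * set T1) : exists U' : set T1, nbhs (1 : T1) nU.2 ->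
    [/\ nbhs (1 : T1) U', forall x y, U' x -> U' y -> nU.2 (x / y) &
        forall v x, U' v -> K1 nU.1 x -> nU.2 (v ^ x)].
  have [nnU|] := pselect (nbhs (1 : T1) nU.2); last by exists setT.
  have [A nA Adiv] := nbhs_div mulC nnU.
  have [B nB Bconj] := nbhs_conj_compact mulC (@cK1 nU.1) nnU.
  exists (A `&` B) => _; split; first exact: filterI.
    by move=> x y [Ax _] [Ay _]; exact: Adiv.
  by move=> v x [_ Bv]; exact: Bconj.
have [F FP] := choice step.
pose U n := iteri n (fun n U => F (n, U)) U0.
have nU n : nbhs (1 : T1) (U n).
  by elim: n => [//|n IH]; have [] := FP (n, U n) IH.
have divU n (x y : T1) : U n.+1 x -> U n.+1 y -> U n (x / y).
  by have [_ + _] := FP (n, U n) (nU n); exact.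
have conjU n (v x : T1) : U n.+1 v -> K1 n x -> U n (v ^ x).
  by have [_ _] := FP (n, U n) (nU n); exact.
have KU : exists n, U 0 `<=` K1 n by exists j; exact: subIsetr.
pose N := kernel mK1 nK1 nU divU conjU.
pose Q := topologized (quot_topology t1 N).
pose H : topologicalGroupType := HB.pack Q (isTopologicalGroup.Build Q
  (@quot_mul_continuous _ t1 mulC N) (@continuous_invg _ (quot_topology t1 N))).
pose pi : topologized t -> H := fun x => qpi N (p1 x).
have nbhs_pi (x : topologized t) A : nbhs x A -> nbhs (pi x) (pi @` A).
  move=> nA; have := @qpi_nbhs _ t1 N _ _ (@qpi_nbhs _ t N0 x A nA).
  by rewrite image_comp.
have pi_surj h : exists x, pi x = h.
  by exists (val (val h)); rewrite /pi /p1 !valqK.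
have pi_cont : continuous pi.
  move=> x; apply: (cvg_comp p1 (qpi N) (@qpi_continuous _ t N0 x)).
  exact: qpi_continuous.
have hH : hausdorff_space H by exact: kernel_hausdorff.
exists H, pi; split; split=> //.
- exact: kernel_second_countable.
- apply: locally_compact_nbhs => // h; have [x <-] := pi_surj h.
  have [n nx] := nK x; exists (pi @` K n); last exact: nbhs_pi.
  by apply: continuous_compact; [exact: continuous_subspaceT|exact: cK].
- by move=> x y; rewrite /pi /p1 !qpiM.
exists (qpi N @` U0); first exact: (@qpi_nbhs _ t1 N 1).
move=> x /= [u Uu /esym/qpi_eq Nxu].
(* The kernel is absorbed by a division in [V]; the inseparable part is absorbed afterwards by the
   closure of [W]. *)
have : (p1 @` W°) (p1 x).
  have -> : p1 x = u / ((p1 x)^-1 * u) by rewrite invgM invgK mulVKg.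
  by apply: VW; [exact: Uu.1|exact: (Nxu 0%N I).1].
move=> [w Ww /qpi_eq Nwx].
have -> : x = w * (w^-1 * x) by rewrite mulVKg.
apply: (closureS (@interior_subset _ W)).
apply: closure_mul_inseparable => //; first exact: open_interior.
exact: subset_closure.
Qed.

(** * Bounded ultrafilters *)

(** [Zorn_bigcup] is applied to the sets [F] with [P (F ∪ F0)]; this also settles the empty chain,
    whose union is empty. *)
Lemma Zorn_above (T : Type) (P : set (set T)) (F0 : set T) :
  P F0 ->
  (forall C : set (set T), C !=set0 -> C `<=` P -> total_on C subset ->
    P (\bigcup_(F in C) F)) ->
  exists A, [/\ P A, F0 `<=` A & forall B, P B -> A `<=` B -> B `<=` A].
Proof.
move=> PF0 PC; have [C CP totC|A [PA maxA]] :=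
  @Zorn_bigcup T [set F | P (F `|` F0)].
  have [[F1 CF1]|C0] := pselect (C !=set0); last first.
    rewrite /= (_ : \bigcup_(F in C) F = set0) ?set0U //.
    by apply/seteqP; split=> // x [F CF _]; apply: C0; exists F.
  rewrite /= (_ : _ `|` F0 = \bigcup_(F in [set F `|` F0 | F in C]) F).
    apply: PC; first by exists (F1 `|` F0), F1.
      by move=> _ [F CF <-]; exact: CP.
    move=> _ _ [F CF <-] [F' CF' <-].
    by have [h|h] := totC F F' CF CF'; [left|right]; exact: setSU.
  apply/seteqP; split=> [x [[F CF Fx]|F0x]|x [_ [F CF <-] [Fx|F0x]]].
  - by exists (F `|` F0); [exists F|left].
  - by exists (F1 `|` F0); [exists F1|right].
  - by left; exists F.
  - by right.
exists (A `|` F0); split=> // B PB AB; have AB' : A `<=` B.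
  by apply: subset_trans AB; exact: subsetUl.
apply: contrapT => nBA; apply: (maxA B); last first.
  have BF0 : B `|` F0 = B.
    by apply/setUidPl; apply: subset_trans AB; exact: subsetUr.
  by rewrite /= BF0.
split=> //; apply: contra_not nBA => BA; apply: subset_trans BA _.
exact: subsetUl.
Qed.

Lemma proper_ultra (T : Type) (p : set_system T) :
  ProperFilter p -> (forall A, p A \/ p (~` A)) -> UltraFilter p.
Proof.
move=> Pp pV; split=> // q Pq pq; apply/seteqP; split=> // A qA.
have [//|/pq nA] := pV A.
have : q (A `&` ~` A) by exact: filterI.
by rewrite setICr => /filter_not_empty.
Qed.

Lemma ultra_ex (T : Type) (F : set_system T) : F !=set0 ->
  (forall A B, F A -> F B -> F (A `&` B)) -> (forall A, F A -> A !=set0) ->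
  exists2 p : set_system T, UltraFilter p & F `<=` p.
Proof.
move=> [A0 FA0] FI F0.
have PF : ProperFilter (filter_from F id).
  apply: filter_from_proper => //.
  apply: filter_from_filter; first by exists A0.
  by move=> A B FA FB; exists (A `&` B) => //; exact: FI.
have [p [up Fp]] := ultraFilterLemma PF.
by exists p => // A FA; apply: Fp; exists A.
Qed.

Section Powers.
Context {G : groupType} (L : set G).
Local Notation X n := (expset L n).

Hypothesis approxL : approximate_subgroup L.

Let L1 : L 1. Proof. by case: approxL. Qed.

Let LV x : L x -> L x^-1.
Proof.
by case: approxL => _ e _; rewrite {1}e => -[y Ly <-]; rewrite invgK.
Qed.

Lemma expset1 n : X n 1.
Proof.
elim: n => [//|n IH]; rewrite expsetS; exists 1 => //.
by exists 1 => //; rewrite mulg1.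
Qed.

Lemma expset_sub n m : (n <= m)%N -> X n `<=` X m.
Proof.
move=> /subnKC <- x Xx; rewrite -[x]mulg1; apply: expsetD => //; exact: expset1.
Qed.

Lemma expsetV n x : X n x -> X n x^-1.
Proof.
elim: n x => [|n IH] x; first by move=> /= ->; exact: invg1.
rewrite {1}expsetS => -[a La [b /IH Xb <-]]; rewrite invgM -addn1.
by apply: expsetD => //; exact: LV.
Qed.

(** Induction: if [b] lies in [L f'], then [a * b] lies in [X 2 f'], and [X 2] is covered by
    finitely many translates [L f]. *)
Lemma expset_cover n : exists2 F : set G, finite_set F &
  forall x, X n x -> exists2 k, F k & L (x * k^-1).
Proof.
have [_ _ [_ [F finF LF]]] := approxL.
elim: n => [|n [F' finF' IH]].
  by exists [set 1] => // x /= ->; exists 1 => //; rewrite invg1 mulg1.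
exists [set f * f' | f in F & f' in F']; first exact: finite_image2.
move=> x; rewrite expsetS => -[a La [b /IH[f' Ff' Lb] <-]].
have : X 2 (a * (b / f')) by exists a => //; exists (b / f').
move=> /LF[f Ff [c Lc e]].
exists (f * f'); first by exists f => //; exists f'.
by rewrite invgM mulgA -(mulgA a) -e mulgK.
Qed.

Hypothesis genL : generated_by L.

Lemma expset_all g : exists n, X n g.
Proof.
have sub : is_subgroup (\bigcup_n X n).
  split; first by exists 0%N.
  move=> x y [n _ Xx] [m _ Xy]; exists (n + m) => //.
  by apply: expsetD => //; exact: expsetV.
have : [set: G] g by [].
rewrite -genL => /(_ (\bigcup_n X n)) /= [|n _ Xg]; last by exists n.
by split=> // x Lx; exists 1%N.
Qed.

End Powers.

(** These are the points of the Stone-Cech compactification of the discrete group [G] that lie in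
    the closure of some power of [L]. *)
Record bultra (G : groupType) (L : set G) := BUltra {
  bu_sets :> set G -> Prop ;
  bu_ultra : UltraFilter bu_sets ;
  bu_bounded : exists n, bu_sets (expset L n)
}.

HB.instance Definition _ (G : groupType) (L : set G) :=
  gen_eqMixin (bultra L).
HB.instance Definition _ (G : groupType) (L : set G) :=
  gen_choiceMixin (bultra L).

Section BoundedUltrafilters.
Context {G : groupType} (L : set G).
Local Notation X n := (expset L n).
Local Notation S := (bultra L).
Implicit Types (p q r : S) (A B : set G).

Lemma bu_filter p : ProperFilter p.
Proof. exact: (@ultra_proper _ _ (bu_ultra p)). Qed.

Lemma buT p : p setT.
Proof. have := bu_filter p; move=> pp; exact: filterT. Qed.

Lemma buI p A B : p A -> p B -> p (A `&` B).
Proof. have := bu_filter p; move=> pp; exact: filterI. Qed.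

Lemma buS p A B : A `<=` B -> p A -> p B.
Proof. have := bu_filter p; move=> pp; exact: filterS. Qed.

Lemma bu_ex p A : p A -> A !=set0.
Proof. have := bu_filter p; move=> pp; exact: filter_ex. Qed.

Lemma buC p A : p A \/ p (~` A).
Proof. exact: in_ultra_setVsetC (bu_ultra p). Qed.

Lemma buN p A : ~ p A -> p (~` A).
Proof. by have [] := buC p A. Qed.

Lemma bu_meet p A B : p A -> p B -> exists x, A x /\ B x.
Proof. by move=> pA pB; have [x] := bu_ex (buI pA pB); exists x. Qed.

Lemma bu_eq p q : (forall A, p A -> q A) -> p = q.
Proof.
move=> pq; have e : bu_sets p = bu_sets q.
  apply/funext => A; apply/propext; split; first exact: pq.
  move=> qA; apply: contrapT => /buN/pq nqA.
  by have [x []] := bu_meet qA nqA.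
case: p q e {pq} => [p up bp] [q uq bq] /= e; rewrite e in up bp *.
by congr BUltra; exact: Prop_irrelevance.
Qed.

Definition umul (p q : set_system G) : set_system G :=
  [set A | p [set g | q [set h | A (g * h)]]].

Lemma umul_ultra (p q : S) : UltraFilter (umul p q).
Proof.
apply: proper_ultra.
  apply: Build_ProperFilter_ex.
    by move=> A /bu_ex[g /bu_ex[h Agh]]; exists (g * h).
  split; first by apply: buS (buT p) => g _; exact: buT.
    move=> A B pA pB; apply: buS (buI pA pB) => g [qA qB]; exact: buI.
  by move=> A B AB; apply: buS => g; apply: buS => h /AB.
move=> A; have [|/buN nA] := pselect (umul p q A); first by left.
by right; apply: buS nA => g /buN.
Qed.

Lemma umul_bounded (p q : S) : exists n, umul p q (X n).
Proof.
have [n pn] := bu_bounded p; have [m qm] := bu_bounded q.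
by exists (n + m); apply: buS pn => g Xg; apply: buS qm => h; exact: expsetD.
Qed.

Definition bu_mul p q : S := BUltra (umul_ultra p q) (umul_bounded p q).

Lemma dirac_ultra (g : G) : UltraFilter [set A : set G | A g].
Proof.
apply: proper_ultra => [|A]; last by have [|] := pselect (A g); [left|right].
by apply: Build_ProperFilter_ex => [A Ag|]; [exists g|split=> // A B; exact].
Qed.

Lemma bu_mulA : associative bu_mul.
Proof.
move=> p q r; apply: bu_eq => A /=; rewrite /umul /=.
by apply: buS => g; apply: buS => h; apply: buS => k; rewrite /= mulgA.
Qed.

Definition bu_one : S :=
  BUltra (dirac_ultra 1)
    (ex_intro (fun n => [set A : set G | A 1] (X n)) 0%N erefl).

Lemma bu_mul1 : left_id bu_one bu_mul.
Proof.
by move=> p; apply: bu_eq => A; apply: (@buS p) => h; rewrite /= mul1g.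
Qed.

Lemma bu_mul1r : right_id bu_one bu_mul.
Proof.
by move=> p; apply: bu_eq => A; apply: (@buS p) => h; rewrite /= mulg1.
Qed.

HB.instance Definition _ := isMonoid.Build S bu_mulA bu_mul1 bu_mul1r.

Lemma bu_mulS p q A B :
  (forall g, q [set h | A (g * h)] -> B g) -> (p * q)%g A -> p B.
Proof. by move=> AB pqA; apply: (@buS p [set g | q [set h | A (g * h)]]). Qed.

Lemma bu_mulW p q q' A B :
  (forall g, q [set h | A (g * h)] -> q' [set h | B (g * h)]) ->
  (p * q)%g A -> (p * q')%g B.
Proof. by move=> AB; exact: bu_mulS. Qed.

Hypothesis approxL : approximate_subgroup L.
Hypothesis genL : generated_by L.

Definition dirac (g : G) : S :=
  BUltra (dirac_ultra g) (expset_all approxL genL g).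

Lemma diracM g h : dirac (g * h) = dirac g * dirac h.
Proof. by apply: bu_eq. Qed.

Lemma dirac1 : dirac 1 = 1. Proof. by apply: bu_eq. Qed.

Lemma bu_in_finite p (F : set G) (c : G -> set G) A : finite_set F -> p A ->
  A `<=` \bigcup_(k in F) c k -> exists2 k, F k & p (c k).
Proof.
move=> /finite_seqP[s ->] pA AF; apply: contrapT => nF.
have : p [set x | forall k, k \in s -> ~ c k x].
  have : forall k, k \in s -> ~ p (c k) by move=> k ks pck; apply: nF; exists k.
  elim: s {AF nF} => [|k s IH] ns; first by apply: buS (buT p) => x _ k.
  have /IH ps : forall k, k \in s -> ~ p (c k).
    by move=> l ls; apply: ns; rewrite inE ls orbT.
  apply: buS (buI (buN (ns k (mem_head _ _))) ps) => x [nkx sx] l.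
  by rewrite inE => /predU1P[->|/sx].
by move=> /(bu_meet pA)[x [/AF[k ks ckx] /(_ k ks)]].
Qed.

(** One of finitely many translates of [L] covering a power must belong to [p]. Every later estimate
    starts from such a translate, so its bound does not depend on how large [p] is. *)
Lemma bu_cover p : exists k, p [set x | L (x * k^-1)].
Proof.
have [n pn] := bu_bounded p; have [F finF XF] := expset_cover approxL n.
have [|k _ pk] := @bu_in_finite p F (fun k => [set x | L (x * k^-1)]) _ finF pn.
  by move=> x /XF[k Fk Lk]; exists k.
by exists k.
Qed.

Lemma bu_coverl p : exists k, p [set x | L (k * x)].
Proof.
have [n pn] := bu_bounded p; have [F finF XF] := expset_cover approxL n.
have [|k _ pk] := @bu_in_finite p F (fun k => [set x | L (k * x)]) _ finF pn.
  move=> x /(expsetV approxL)/XF[k Fk Lk]; exists k => //=.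
  by have := expsetV approxL (n := 1) Lk; rewrite invgM !invgK.
by exists k.
Qed.

End BoundedUltrafilters.

(** * Minimal left ideals and their idempotents *)

Section MinimalIdempotent.
Context {G : groupType} (L : set G).
Hypothesis approxL : approximate_subgroup L.
Hypothesis genL : generated_by L.
Local Notation X n := (expset L n).
Local Notation S := (bultra L).
Implicit Types (p q r s : S) (A B D : set G) (F : set (set G)).

(** A proper filter, spelled out for arbitrary families of sets so that Zorn's lemma applies to
    it. *)
Definition base F :=
  [/\ F setT, forall A B, F A -> F B -> F (A `&` B),
      forall A B, A `<=` B -> F A -> F B & forall A, F A -> A !=set0].

Lemma base_bigcup (C : set (set (set G))) : C !=set0 -> C `<=` base ->
  total_on C subset -> base (\bigcup_(F in C) F).
Proof.
move=> [F0 CF0] CP totC; split.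
- by exists F0 => //; have [] := CP _ CF0.
- move=> A B [F CF FA] [F' CF' FB].
  have [h|h] := totC F F' CF CF'.
    by exists F' => //; have [_ + _ _] := CP _ CF'; apply=> //; exact: h.
  by exists F => //; have [_ + _ _] := CP _ CF; apply=> //; exact: h.
- move=> A B AB [F CF FA]; exists F => //.
  by have [_ _ + _] := CP _ CF; apply; eauto.
- by move=> A [F CF FA]; have [_ _ _ +] := CP _ CF; apply.
Qed.

(** Invariance under translation makes the ultrafilters extending [F] a left ideal; meeting [L]
    ensures that one of them is bounded. *)
Definition inv_filter F := [/\ base F,
  forall A g, F A -> F [set h | A (g * h)] &
  forall A, F A -> exists2 x, A x & L x].

(* Through its family of ultrafilter extensions, a maximal such filter is a
   minimal closed left ideal of the semigroup of bounded ultrafilters. *)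
Lemma max_inv_filter : exists2 I, inv_filter I &
  forall F, inv_filter F -> I `<=` F -> F `<=` I.
Proof.
have L1 : L 1 by case: approxL.
have [||I [PI _ maxI]] := @Zorn_above _ inv_filter [set setT]; last first.
- by exists I.
- move=> C C0 CP totC; split; first by apply: base_bigcup => // F /CP[].
    move=> A g [F CF FA]; exists F => //.
    by have [_ + _] := CP _ CF; apply.
  by move=> A [F CF FA]; have [_ _] := CP _ CF; apply.
split; last by move=> A ->; exists 1.
  split=> //; first by move=> A B -> ->; rewrite setIT.
    by move=> A B AB eA; apply/seteqP; split=> // x _; apply: AB; rewrite eA.
  by move=> A ->; exists 1.
by move=> A g ->.
Qed.

Section Ideal.
Variable I : set (set G).
Hypothesis invI : inv_filter I.
Hypothesis maxI : forall F, inv_filter F -> I `<=` F -> F `<=` I.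

Definition ideal := [set p : S | I `<=` p].

Lemma ideal_ex : ideal !=set0.
Proof.
have [[IT II IS _] Iinv IL] := invI.
have [|||p up Fp] := @ultra_ex G [set B | exists2 A, I A & A `&` L `<=` B].
- by exists setT, setT.
- move=> B B' [A IA AB] [A' IA' AB']; exists (A `&` A'); first exact: II.
  by move=> x [[Ax A'x] Lx]; split; [apply: AB|apply: AB'].
- by move=> B [A /IL[x Ax Lx] AB]; exists x; exact: AB.
have bp : exists n, p (X n).
  by exists 1%N; apply: Fp; exists setT => // x [].
exists (BUltra up bp) => A IA; apply: Fp; exists A => //; exact: subIsetl.
Qed.

Lemma ideal_mul s p : ideal p -> ideal (s * p).
Proof.
move=> Ip A IA; apply: buS (buT s) => g _ /=; apply: Ip.
by have [_ + _] := invI; apply.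
Qed.

(** The sets all of whose translates belong to [p] form the invariant filter of the left ideal
    [S p]. It contains [I], so by maximality it equals [I]. Hence the sets [D A] with [A] in [q] are
    nonempty, and an ultrafilter [s] containing them all satisfies [s * p = q]. *)
Lemma ideal_trans p q : ideal p -> ideal q -> exists s, s * p = q.
Proof.
have [[IT II IS _] Iinv IL] := invI.
move=> Ip Iq; pose F := [set A | forall g, p [set h | A (g * h)]].
have PF : inv_filter F.
  split; [split|..].
  - by move=> g; exact: buT.
  - by move=> A B FA FB g; exact: (buI (FA g) (FB g)).
  - by move=> A B AB FA g; apply: buS (FA g) => h; exact: AB.
  - by move=> A FA; have [h Ah] := bu_ex (FA 1); exists (1 * h).
  - by move=> A g FA k; apply: buS (FA (g * k)) => h; rewrite /= mulgA.
  move=> A FA; have [k pk] := bu_coverl approxL p.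
  by have [h [Lh Ah]] := bu_meet pk (FA k); exists (k * h).
have FI : F `<=` I.
  by apply: maxI => // A IA g; apply: Ip; exact: Iinv.
pose D A := [set g | p [set h | A (g * h)]].
have [|||s us Fs] := @ultra_ex G [set B | exists2 A, q A & D A `<=` B].
- by exists setT, setT => //; exact: buT.
- move=> B B' [A qA AB] [A' qA' AB']; exists (A `&` A'); first exact: buI.
  move=> g pg; split; [apply: AB|apply: AB'].
    by apply: buS pg => h [].
  by apply: buS pg => h [].
- move=> B [A qA AB]; apply: contrapT => B0.
  suff /FI/Iq nA : F (~` A) by have [x []] := bu_meet qA nA.
  move=> g; apply: (@buN _ _ p) => pg; apply: B0; exists g; exact: AB.
have bs : exists n, s (X n).
  have [n qn] := bu_bounded q; have [m pm] := bu_bounded p.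
  exists (n + m); apply: Fs; exists (X n) => // g pg.
  have [h [Xgh Xh]] := bu_meet pg pm.
  by rewrite -(mulgK h g); apply: expsetD => //; exact: expsetV.
exists (BUltra us bs); apply/esym/bu_eq => A qA.
by apply: Fs; exists A.
Qed.

(** The second clause makes the ultrafilters extending [F] closed under products. *)
Definition idem_filter F := base F /\
  forall A, F A -> F [set g | F [set h | A (g * h)]].

(* An idempotent is reached as in the Ellis-Numakura lemma, with filters in
   place of closed subsemigroups. *)
Lemma ideal_idempotent : exists2 u, ideal u & u * u = u.
Proof.
have [[IT II IS _] Iinv IL] := invI.
have [p Ip] := ideal_ex.
have [m Im mp] : exists2 m, ideal m & m * p = p.
  have [s sp] := ideal_trans (ideal_mul p Ip) Ip.
  by exists (s * p); [exact: ideal_mul|rewrite -mulgA].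
pose E (q : S) A := [set g | q [set h | A (g * h)]].
(* The filter built here describes the extensions [x] of [F] with [x * q = q], again a closed
   subsemigroup. *)
have idemE (F : set (set G)) (q : S) : base F ->
    (forall A, F A -> F [set g | F [set h | A (g * h)]]) ->
    (forall A B, F A -> q B -> A `&` E q B !=set0) ->
    idem_filter [set D | exists A B, [/\ F A, q B & A `&` E q B `<=` D]].
  move=> [FT FI FS _] Fid F0; split; [split|].
  - by exists setT, setT; split=> //; exact: buT.
  - move=> D D' [A [B [FA qB ABD]]] [A' [B' [FA' qB' ABD']]].
    exists (A `&` A'), (B `&` B'); split; [exact: FI|exact: buI|].
    move=> g [[Ag A'g] Eg]; split.
      by apply: ABD; split=> //; apply: buS Eg => h [].
    by apply: ABD'; split=> //; apply: buS Eg => h [].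
  - by move=> D D' DD' [A [B [FA qB ABD]]]; exists A, B; split=> // x /ABD/DD'.
  - move=> D [A [B [FA qB ABD]]]; have [x] := F0 A B FA qB.
    by exists x; exact: ABD.
  move=> D [A [B [FA qB ABD]]].
  exists [set g | F [set h | A (g * h)]], B; split=> //; first exact: Fid.
  move=> g [/= FAg EBg]; exists [set h | A (g * h)], [set k | B (g * k)].
  split=> // h [Agh EBgh]; apply: ABD; split=> //.
  by apply: buS EBgh => k; rewrite /= mulgA.
pose F0 := [set D | exists A B, [/\ I A, p B & A `&` E p B `<=` D]].
have F0id : idem_filter F0.
  apply: idemE => //.
    by have [] := invI.
    by move=> A IA; apply: IS IT => g _ /=; exact: Iinv.
  move=> A B IA pB; have mE : m (E p B) by have : (m * p)%g B by rewrite mp.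
  by have [x] := bu_meet (Im A IA) mE; exists x.
have [|C C0 CP totC|F [[[FT FI FS FN] Fid] F0F maxF]] :=
  @Zorn_above _ idem_filter F0 => //.
  split; first by apply: base_bigcup => // F /CP[].
  move=> A [F CF FA]; exists F => //; have [[_ _ FS _] Fid] := CP _ CF.
  by apply: FS (Fid A FA) => g Fg; exists F.
have [|||q' uq Fq] := @ultra_ex G F => //; first by exists setT.
have bq : exists n, q' (X n).
  have [n pn] := bu_bounded p; exists (n + n); apply: Fq; apply: F0F.
  exists setT, (X n); split=> // g [_ Eg].
  have [h [Xgh Xh]] := bu_meet Eg pn.
  by rewrite -(mulgK h g); apply: expsetD => //; exact: expsetV.
pose q := BUltra uq bq; have {}Fq : F `<=` q by [].
(* The left side is the filter of the products [x * q] with [x] extending [F]; it contains [F], and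
   [F] is maximal. *)
have Eq1 : [set A | F (E q A)] `<=` F.
  apply: maxF; last first.
    by move=> A FA; apply: FS (Fid A FA) => g; exact: Fq.
  split; [split|].
  - by apply: FS FT => g _; exact: buT.
  - by move=> A B FA FB; apply: FS (FI _ _ FA FB) => g [qA qB]; exact: buI.
  - by move=> A B AB; apply: FS => g; apply: buS => h; exact: AB.
  - by move=> A /FN[g /bu_ex[h Agh]]; exists (g * h).
  move=> A FA; apply: (FS _ _ _ (Fid _ (Fid _ FA))) => g.
  move=> /Fq; apply: buS => k; apply: (FS _ _ _) => h /=.
  by apply: (@buS _ _ q) => l /=; rewrite !mulgA.
have Eq2 : forall A, q A -> F (E q A).
  have h : [set D | exists A B, [/\ F A, q B & A `&` E q B `<=` D]] `<=` F.
    apply: maxF; last by move=> A FA; exists A, setT; split=> //; exact: buT.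
    apply: idemE => //.
    move=> A B FA qB; apply: contrapT => AB0.
    suff /Fq nB : F (~` B) by have [x []] := bu_meet qB nB.
    apply: Eq1; apply: FS FA => g Ag; apply: (@buN _ _ q) => qg.
    by apply: AB0; exists g.
  by move=> A qA; apply: h; exists setT, A; split.
exists q; last by apply/esym/bu_eq => A /Eq2/Fq.
move=> A IA; apply: Fq; apply: F0F; exists A, setT; split=> //; exact: buT.
Qed.

End Ideal.

(** Minimality enters only as left invertibility of the elements [u * s * u], which makes [u S u] a
    group. *)
Lemma minimal_idempotent : exists2 u : S, u * u = u &
  forall s, exists s', s' * (u * s * u) = u.
Proof.
have [I invI maxI] := max_inv_filter.
have [u Iu uu] := ideal_idempotent invI maxI.
exists u => // s; apply: (ideal_trans invI maxI) => //.
exact: ideal_mul.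
Qed.

End MinimalIdempotent.

(** * The Ellis group and its tau topology *)

Record min_idem (G : groupType) (L : set G) := MinIdem {
  mi_val :> bultra L ;
  mi_idem : mi_val * mi_val = mi_val ;
  mi_inv : forall s, exists s', s' * (mi_val * s * mi_val) = mi_val
}.

Section EllisGroup.
Context {G : groupType} {L : set G} (mi : min_idem L).
Local Notation u := (mi_val mi).
Local Notation X n := (expset L n).
Local Notation S := (bultra L).

Definition ellis_group := {p : S | `[< u * p = p /\ p * u = p >]}.

HB.instance Definition _ := Choice.on ellis_group.

Implicit Types (x y z : ellis_group) (s : S).

Definition ev x : S := sval x.

Lemma ev_inj : injective ev. Proof. exact: val_inj. Qed.

Lemma ellis_mull x : u * ev x = ev x. Proof. by have /asboolP[] := valP x. Qed.
Lemma ellis_mulr x : ev x * u = ev x. Proof. by have /asboolP[] := valP x. Qed.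

Lemma ellis_proj_subproof s :
  `[< u * (u * s * u) = u * s * u /\ (u * s * u) * u = u * s * u >].
Proof. by apply/asboolP; rewrite -!mulgA mi_idem !mulgA mi_idem. Qed.

Definition ellis_proj s : ellis_group :=
  exist _ (u * s * u) (ellis_proj_subproof s).

Definition eg_mul x y := ellis_proj (ev x * ev y).
Definition eg_one := ellis_proj 1.

Lemma eg_mulE x y : ev (eg_mul x y) = ev x * ev y.
Proof. by rewrite /= mulgA ellis_mull -mulgA ellis_mulr. Qed.

Lemma eg_oneE : ev eg_one = u.
Proof. by rewrite /= mulg1 mi_idem. Qed.

Lemma eg_inv_ex x : exists y, ev y * ev x = u.
Proof.
have [s su] := mi_inv mi (ev x); exists (ellis_proj s).
rewrite ellis_mull ellis_mulr in su.
by rewrite /= -(mulgA _ _ (ev x)) ellis_mull -mulgA su mi_idem.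
Qed.

Definition eg_inv x := projT1 (cid (eg_inv_ex x)).

Lemma eg_invE x : ev (eg_inv x) * ev x = u.
Proof. exact: projT2 (cid (eg_inv_ex x)). Qed.

Lemma eg_mulA : associative eg_mul.
Proof. by move=> x y z; apply: ev_inj; rewrite !eg_mulE mulgA. Qed.

Lemma eg_mul1 : left_id eg_one eg_mul.
Proof. by move=> x; apply: ev_inj; rewrite eg_mulE eg_oneE ellis_mull. Qed.

Lemma eg_mul1r : right_id eg_one eg_mul.
Proof. by move=> x; apply: ev_inj; rewrite eg_mulE eg_oneE ellis_mulr. Qed.

Lemma eg_mulV : left_inverse eg_one eg_inv eg_mul.
Proof. by move=> x; apply: ev_inj; rewrite eg_mulE eg_oneE eg_invE. Qed.

Lemma eg_mulVr : right_inverse eg_one eg_inv eg_mul.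
Proof.
move=> x; rewrite -[LHS]eg_mul1 -{1}(eg_mulV (eg_inv x)).
by rewrite -eg_mulA (eg_mulA _ x) eg_mulV eg_mul1 eg_mulV.
Qed.

HB.instance Definition _ := isGroup.Build ellis_group
  eg_mulA eg_mul1 eg_mul1r eg_mulV eg_mulVr.

Lemma ev_mul x y : ev (x * y) = ev x * ev y. Proof. exact: eg_mulE. Qed.
Lemma ev_one : ev (1 : ellis_group) = u. Proof. exact: eg_oneE. Qed.

(* A point [a] is in the tau closure of [A] if it is a limit of products [g b]
   with [b] in [A] and [g] in [G] tending to [u]. *)
Definition tau_nb (V Y : set G) : set ellis_group :=
  [set b : ellis_group | exists2 g, Y g & ev b [set h | V (g * h)]].

Definition tau_open (A : set ellis_group) :=
  forall a, A a -> exists V Y, [/\ ev a V, u Y & tau_nb V Y `<=` A].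

Lemma tau_openT : tau_open setT.
Proof. by move=> a _; exists setT, setT; split=> //; exact: buT. Qed.

Lemma tau_openI : setI_closed tau_open.
Proof.
move=> A B oA oB a [/oA[V [Y [aV uY VA]]] /oB[V' [Y' [aV' uY' VB]]]].
exists (V `&` V'), (Y `&` Y'); split; [exact: buI|exact: buI|].
move=> b [g [Yg Y'g] bg]; split; [apply: VA|apply: VB]; exists g => //.
  by apply: buS bg => h [].
by apply: buS bg => h [].
Qed.

Lemma tau_open_bigU (I : Type) (f : I -> set ellis_group) :
  (forall i, tau_open (f i)) -> tau_open (\bigcup_i f i).
Proof.
move=> of_ a [i _ /of_[V [Y [aV uY Vf]]]]; exists V, Y; split=> // b /Vf fb.
by exists i.
Qed.

Lemma tau_openMr (a : ellis_group) A :
  tau_open A -> tau_open [set x | A (x * a)].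
Proof.
move=> oA x /oA[V [Y [xaV uY VA]]].
exists [set k | ev a [set h | V (k * h)]], Y; split=> //.
  by move: xaV; rewrite ev_mul.
move=> b [g Yg bg]; apply: VA; exists g => //; rewrite ev_mul.
by apply: buS bg => h; apply: buS => k; rewrite /= mulgA.
Qed.

(** One [h] typical for [x^-1] serves both [V] and [Y]. For [b] near [x], the identity
    [u = b * b^-1] splits a typical element for [u] into [k] followed by one for [b^-1], and
    [h * g * k] witnesses that [b^-1] is near [x^-1]. *)
Lemma tau_openV A : tau_open A -> tau_open [set x | A x^-1].
Proof.
move=> oA x /oA[V [Y [xV uY VA]]].
have h1 : ev x^-1 [set h | u [set k | V (h * k)]].
  by have : (ev x^-1 * u)%g V by rewrite ellis_mulr.
have h2 : ev x^-1 [set h | ev x [set k | Y (h * k)]].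
  by have : (ev x^-1 * ev x)%g Y by rewrite -ev_mul mulVg ev_one.
have [h [hV hY]] := bu_meet h1 h2.
exists [set k | Y (h * k)], [set g | u [set k | V (h * g * k)]]; split=> //.
  have : (u * u)%g [set k | V (h * k)] by rewrite mi_idem.
  by apply: bu_mulS => g; apply: buS => k; rewrite /= mulgA.
move=> b [g gV bg]; apply: VA.
have : (ev b * ev b^-1)%g [set k | V (h * g * k)].
  by rewrite -ev_mul mulgV ev_one.
move=> /(bu_meet bg)[k [Yk bk]]; exists (h * g * k); first by rewrite -mulgA.
by apply: buS bk => l; rewrite /= !mulgA.
Qed.

Definition tau : group_topology ellis_group :=
  GroupTopology tau_openT tau_openI tau_open_bigU tau_openMr tau_openV.

Local Notation T := (topologized tau).

(** Since [u] is idempotent, [Y] shrinks to [Y'] such that each [g] in [Y'] satisfies [Y' (g * h)]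
    for [u]-almost all [h]; then [tau_nb V Y'] is open. *)
Lemma tau_nb_nbhs (a : T) (V Y : set G) : ev a V -> u Y -> nbhs a (tau_nb V Y).
Proof.
move=> aV uY; pose Y' := Y `&` [set g | u [set h | Y (g * h)]].
have uY' : u Y'.
  by apply: buI => //; have : (u * u)%g Y by rewrite mi_idem.
rewrite nbhsE; exists (tau_nb V Y'); last by move=> b [g [Yg _] bg]; exists g.
split; last first.
  have : (u * ev a)%g V by rewrite ellis_mull.
  by move=> /(bu_meet uY')[g [Y'g ag]]; exists g.
move=> b [g [Yg Y'g] bg].
exists [set h | V (g * h)], [set h | Y' (g * h)]; split=> //.
  apply: buI => //.
  have : (u * u)%g [set h | Y (g * h)] by rewrite mi_idem.
  by apply: bu_mulS => h; apply: buS => k; rewrite /= mulgA.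
move=> c [h Y'gh ch]; exists (g * h) => //.
by apply: buS ch => k; rewrite /= mulgA.
Qed.

Lemma nbhs_tau_nb (a : T) (A : set T) : nbhs a A ->
  exists V Y, [/\ ev a V, u Y & tau_nb V Y `<=` A].
Proof.
rewrite nbhsE => -[B [oB Ba] BA]; have [V [Y [aV uY VB]]] := oB a Ba.
by exists V, Y; split=> //; exact: subset_trans BA.
Qed.

(** Testing against every [Y] in [u], rather than asking for [ev a (X n)], gives a condition that
    survives the limits in the tau topology. *)
Definition tau_comp n : set T :=
  [set a : T | forall Y, u Y -> ev a (mulset Y (X n))].

(** The limit [q] of [F] among bounded ultrafilters satisfies [q * u = q] but may leave the Ellis
    group; [u * q] is back in it and is a tau limit of [F]. *)
Lemma tau_comp_compact n : compact (tau_comp n).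
Proof.
rewrite compact_ultra => F uF FK.
pose p : set_system G := [set V | F [set a : T | ev a V]].
have up : UltraFilter p.
  apply: proper_ultra.
    apply: Build_ProperFilter_ex.
      by move=> A pA; have [a /bu_ex] := @filter_ex _ F _ _ pA.
    split; first by apply: (@filterE _ F) => a; exact: buT.
      move=> A B pA pB; apply: (@filterS _ F) (filterI (F := F) pA pB) => a.
      by move=> [aA aB]; exact: buI.
    by move=> A B AB; apply: (@filterS _ F) => a; exact: buS.
  move=> A; have [|FA] := in_ultra_setVsetC [set a : T | ev a A] uF.
    by left.
  by right; apply: (@filterS _ F) FA => a /buN.
have bp : exists n, p (X n).
  have [m um] := bu_bounded u; exists (m + n); apply: (@filterS _ F) FK => a Ka.
  by apply: buS (Ka _ um) => _ [g Xg [h Xh <-]]; exact: expsetD.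
pose q : S := BUltra up bp.
have qu : q * u = q.
  apply/esym/bu_eq => A; apply: (@filterS _ F) => a /=.
  by rewrite -{1}(ellis_mulr a).
pose b : T := ellis_proj q.
have bE : ev b = u * q by rewrite /= -mulgA qu.
exists b; split.
  move=> Y uY; rewrite bE.
  have : (u * u)%g Y by rewrite mi_idem.
  apply: bu_mulS => g uYg; apply: (@filterS _ F) FK => a /(_ _ uYg); apply: buS.
  move=> _ [h Ygh [k Xk <-]]; exists (g * h) => //.
  by exists k => //; rewrite mulgA.
move=> A /nbhs_tau_nb[V [Y [bV uY VA]]].
have uV : u [set g | q [set h | V (g * h)]] by move: bV; rewrite bE.
have [g [Yg qg]] := bu_meet uY uV.
by apply: (@filterS _ F) qg => a ag; apply: VA; exists g.
Qed.

Lemma sub_tau_comp n (a : T) : ev a (X n) -> tau_comp n a.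
Proof.
move=> aX Y uY.
have : (u * ev a)%g (mulset Y (X n)); last by rewrite ellis_mull.
by apply: buS uY => g Yg; apply: buS aX => h Xh; exists g => //; exists h.
Qed.

End EllisGroup.

(** * Errors of the quasi-homomorphism *)

Section Estimates.
Context {G : groupType} {L : set G}.
Local Notation X n := (expset L n).
Local Notation S := (bultra L).
Hypothesis approxL : approximate_subgroup L.
Hypothesis genL : generated_by L.
Implicit Types (p q s v : S) (g h k : G).

Lemma expset_div n m x y : X n x -> X m y -> X (n + m) (x / y).
Proof. by move=> Xx Xy; apply: expsetD => //; exact: expsetV. Qed.

(** For some [k], both [g y k^-1] and [g x y k^-1] lie in [L] for typical [x], [y], by idempotence;
    their quotient is [g x g^-1]. *)
Lemma idem_conj v g : v * v = v -> v [set h | X 2 (g * h / g)].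
Proof.
move=> vv; have [k vk] := bu_cover approxL (dirac approxL genL g * v).
have {}vk : v [set h | L (g * h / k)] by [].
have := vk; rewrite -{1}vv; apply: bu_mulS => x /(bu_meet vk)[y [/= Ly Lxy]].
have -> : g * x / g = (g * (x * y) / k) / (g * y / k).
  by rewrite !invgM !invgK !mulgA mulgVK mulgK.
exact: (@expset_div 1 1).
Qed.

(* The translates of two idempotents by the same element stay uniformly close,
   although the translating element is unbounded. *)
Lemma idem_error s u v d : u * u = u -> v * v = v -> d * (s * u) = s * v ->
  d (X 6).
Proof.
move=> uu vv duv; have [j sj] := bu_cover approxL (s * u).
(* [g h / j] in [L] and [g h / g] in [X 2] put [g / j] in [X 3]; a conjugate of an element typical
   for [v] adds 2. Comparing with [sj] at the end adds 1. *)
have sv : (s * v)%g [set x | X 5 (x / j)].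
  apply: bu_mulW sj => g uj.
  have [h [/= Lh Xh]] := bu_meet uj (idem_conj g uu).
  have Xg : X 3 (g / j).
    have -> : g / j = (g * h / g)^-1 * (g * h / j).
      by rewrite !invgM !invgK !mulgA mulgVK mulgVK.
    by apply: (@expsetD _ _ 2 1) => //; exact: expsetV.
  apply: buS (idem_conj g vv) => k Xk /=.
  have -> : g * k / j = (g * k / g) * (g / j) by rewrite mulgA mulgVK.
  exact: (@expsetD _ _ 2 3).
move: sv; rewrite -duv; apply: bu_mulS => y dy.
have [x [/= Lx Xyx]] := bu_meet sj dy.
have -> : y = (y * x / j) / (x / j) by rewrite invgM invgK mulgA mulgVK mulgK.
exact: (@expset_div 5 1).
Qed.

Variable mi : min_idem L.
Local Notation u := (mi_val mi).
Local Notation E := (ellis_group mi).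
Local Notation T := (topologized (tau mi)).
Implicit Types (a b c x y w rho : E).

Local Notation D g := (dirac approxL genL g).

Lemma ellis_u2 : u (X 2).
Proof.
apply: buS (idem_conj 1 (mi_idem mi)) => h; by rewrite /= mul1g divg1.
Qed.

Definition ellis_map g : E := ellis_proj mi (D g).

Lemma ellis_map1 : ellis_map 1 = 1.
Proof. by congr ellis_proj; exact: dirac1. Qed.

Lemma ev_ellis_map g : ev (ellis_map g) = u * D g * u. Proof. by []. Qed.

Lemma ellis_map_expset n g : X n g -> ev (ellis_map g) (X (n + 4)).
Proof.
move=> Xg; rewrite ev_ellis_map.
have -> : (n + 4 = 2 + n + 2)%N by rewrite addnAC addnC.
apply: buS ellis_u2 => x Xx; apply: buS ellis_u2 => y Xy.
exact: (expsetD (expsetD Xx Xg) Xy).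
Qed.

Lemma ellis_map_expset_inv n g : ev (ellis_map g) (X n) -> X (n + 4) g.
Proof.
rewrite ev_ellis_map => h.
have [z [Xz uz]] : exists z, X 2 z /\ u [set y | X n (z * g * y)].
  exact: bu_meet ellis_u2 h.
have [y [Xy Xzgy]] := bu_meet ellis_u2 uz.
have -> : g = z^-1 * ((z * g * y) / y) by rewrite mulgK mulKg.
have -> : (n + 4 = 2 + (n + 2))%N by rewrite addnCA.
by apply: expsetD; [exact: expsetV|exact: expset_div].
Qed.

Definition bounded_conj : set E :=
  [set c | forall rho, ev (c ^ rho) (X 6)].

Lemma bounded_conj_normal : normal_subset bounded_conj.
Proof. by move=> c x cB rho; rewrite -conjgM. Qed.

Lemma bounded_conj1 : bounded_conj 1.
Proof.
by move=> rho; rewrite conj1g ev_one; apply: buS ellis_u2; exact: expset_sub.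
Qed.

(** With [r] the image of [h], the element [v = h u r^-1] is idempotent and [v r = h u], so the
    image of [g * h] is [u g v r]. The conjugated error therefore sends [s * u] to [s * v] for
    [s = z g], and [idem_error] applies. *)
Lemma ellis_map_error g h :
  bounded_conj ((ellis_map g * ellis_map h)^-1 * ellis_map (g * h)).
Proof.
set e := (_ * _)%g; move=> rho.
pose r := ellis_map h; pose sg := ellis_map g.
pose v : S := D h * u * ev r^-1.
have uv : u * v = u.
  rewrite /v !mulgA -[u * D h * u]/(ev r) -ev_mul mulgV; exact: ev_one.
have vv : v * v = v.
  by rewrite {1}/v -(ellis_mulr r^-1) -!mulgA uv ellis_mulr !mulgA.
have vu : v * u = v by rewrite /v -!mulgA ellis_mulr.
have vr : v * ev r = D h * u.
  by rewrite /v -!mulgA -ev_mul mulVg ev_one mi_idem.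
pose z : E := rho^-1 * r^-1 * sg^-1.
pose s : S := ev z * D g.
have su : s * u = ev (rho^-1 * r^-1).
  have sgE : u * (D g * u) = ev sg by rewrite mulgA.
  by rewrite /s -(ellis_mulr z) -2!mulgA sgE -ev_mul /z mulgVK.
have fgh : ev (ellis_map (g * h)) = u * (D g * v) * ev r.
  by rewrite ev_ellis_map diracM -[RHS]mulgA -(mulgA (D g) v) vr !mulgA.
apply: (@idem_error s u v _ (mi_idem mi) vv).
rewrite su -ev_mul conjgE /e -/r -/sg.
have -> : rho^-1 * ((sg * r)^-1 * ellis_map (g * h) * rho) * (rho^-1 * r^-1) =
  z * ellis_map (g * h) * r^-1.
  by rewrite /z invgM !mulgA mulgK.
have rr : ev r * ev r^-1 = u by rewrite -ev_mul mulgV ev_one.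
have zu : ev z * u = ev z := ellis_mulr z.
rewrite (ev_mul (z * ellis_map (g * h))) (ev_mul z) fgh /s.
rewrite -(mulgA (ev z)) -(mulgA (u * (D g * v))) rr -(mulgA u) -(mulgA (D g)).
by rewrite vu !mulgA zu.
Qed.

(* [ellis_lim b p] holds for the limit points [b] of [ellis_map] along [p]. *)
Definition ellis_lim b p := forall V Y, ev b V -> u Y ->
  p [set g | exists2 h, Y h & u [set x | V (h * g * x)]].

(** The left factor [u] of [u g u] is replaced by a typical element [x], chosen so that [h * x]
    stays in [Y]. *)
Lemma ellis_lim_cvg (b : T) p :
  (forall A : set T, nbhs b A -> p [set g | A (ellis_map g)]) -> ellis_lim b p.
Proof.
move=> bp V Y bV uY; pose Y' := Y `&` [set g | u [set h | Y (g * h)]].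
have uY' : u Y'.
  by apply: buI => //; have : (u * u)%g Y by rewrite mi_idem.
apply: buS (bp _ (tau_nb_nbhs bV uY')) => g [h [Yh Yh'] uh].
have uh' : u [set x | u [set y | V (h * (x * g * y))]] by exact: uh.
have [x [Yx ux]] := bu_meet Yh' uh'.
by exists (h * x) => //; apply: buS ux => y; rewrite /= !mulgA.
Qed.

(** A product [t h g x] is followed through the translates by [k], [k'] and [j]. The first limit
    shows that [k' x / j] is in [X 3] for typical [x]; since [p'] contains the same set of [g], this
    yields [X 5] for the second limit. Cancelling [rho^-1 * b] adds 1. *)
Lemma ellis_lim_close b b' p p' : ellis_lim b p -> ellis_lim b' p' ->
  (forall k k', p [set g | L (k * g / k')] -> p' [set g | L (k * g / k')]) ->
  bounded_conj (b' / b).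
Proof.
move=> bp bp' pp' rho.
have [j rbj] := bu_cover approxL (ev (rho^-1 * b)).
have rbj' : ev (rho^-1 * b') [set x | X 5 (x / j)].
  move: rbj; rewrite !ev_mul; apply: bu_mulW => t bt.
  have [k tuk] := bu_cover approxL (D t * u).
  have {}tuk : u [set h | L (t * h / k)] by [].
  have [k' kpk] := bu_cover approxL (D k * p).
  have {}kpk : p [set g | L (k * g / k')] by [].
  have [g [/= Lg [h Lh ux]]] := bu_meet kpk (bp _ _ bt tuk).
  have uk' : u [set x | X 3 (k' * x / j)].
    apply: buS ux => x /= Lx.
    have -> : k' * x / j =
        (k * g / k')^-1 * ((t * h / k)^-1 * (t * (h * g * x) / j)).
      by rewrite !invgM !invgK !mulgA !(mulgVK, mulgK).
    apply: (@expsetD _ _ 1 2); first exact: (@expsetV _ _ approxL 1).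
    by apply: (@expsetD _ _ 1 1) => //; exact: (@expsetV _ _ approxL 1).
  apply: contrapT => /buN nb'.
  have [g' [/= Lg' [h' Lh' ux']]] :=
    bu_meet (pp' _ _ kpk) (bp' _ _ nb' tuk).
  have [x [/= Xx]] := bu_meet uk' ux'; apply.
  have -> : t * (h' * g' * x) / j =
      (t * h' / k) * ((k * g' / k') * (k' * x / j)).
    by rewrite !mulgA !(mulgVK, mulgK).
  by apply: (@expsetD _ _ 1 4) => //; apply: (@expsetD _ _ 1 3).
have e : (b' / b) ^ rho * (rho^-1 * b) = rho^-1 * b'.
  by rewrite conjgE -!mulgA mulVKg mulVg mulg1.
move: rbj'; rewrite -e ev_mul; apply: bu_mulS => y dy.
have [x [/= Lx Xyx]] := bu_meet rbj dy.
have -> : y = (y * x / j) / (x / j) by rewrite invgM invgK mulgA mulgVK mulgK.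
exact: (@expset_div 5 1).
Qed.

Definition ellis_nb (l : G) : set T :=
  @tau_nb G L mi [set x | L (x / l)] [set x | L (x / l)].

(** If [w] avoided this set, its complement would define a neighbourhood of [w] meeting
    [ellis_nb l]; a common [x] then gives [g' x / l = (g' / l) (g / l)^-1 (g x / l)], a product of
    three elements of [L]. *)
Lemma closure_ellis_nb l (w : T) : u [set x | L (x / l)] ->
  closure (ellis_nb l) w -> ev w [set x | X 3 (x / l)].
Proof.
move=> ul clw; apply: contrapT => /buN nw.
have [a [[g Lg ag] [g' Lg' ag']]] := clw _ (tau_nb_nbhs nw ul).
have [x [/= Lx]] := bu_meet ag ag'; apply.
have -> : g' * x / l = (g' / l) * ((g / l)^-1 * (g * x / l)).
  by rewrite !invgM !invgK !mulgA !(mulgVK, mulgK).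
apply: (@expsetD _ _ 1 2) => //.
by apply: (@expsetD _ _ 1 1) => //; exact: (@expsetV _ _ approxL 1).
Qed.

Lemma closure_ellis_nb_bounded l : u [set x | L (x / l)] ->
  exists n, forall w : T, closure (ellis_nb l) w -> ev w (X n).
Proof.
move=> ul; have [m Xl] := expset_all approxL genL l; exists (3 + m).
move=> w /(closure_ellis_nb ul); apply: buS => x Xx.
by rewrite -(mulgVK l x); exact: expsetD.
Qed.

(** Here 12 = 2 + (6 + 3) + 1: the left [u] costs 2, [c] and [w] cost 6 and 3, and the right [u]
    costs only 1, as it contains the translate of [L] by [l]. *)
Lemma ellis_map_bounded_conj l c (w : T) g : u [set x | L (x / l)] ->
  bounded_conj c -> closure (ellis_nb l) w -> ellis_map g = c * w -> X 12 g.
Proof.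
move=> ul /(_ 1); rewrite conjg1 => c6 /(closure_ellis_nb ul) w3 fg.
have : (u * D g * u)%g [set x | X 9 (x / l)].
  rewrite -ev_ellis_map fg ev_mul.
  apply: buS c6 => x X6x; apply: buS w3 => y X3y.
  by rewrite /= -mulgA; exact: (@expsetD _ _ 6 3).
move=> h.
have [z [Xz uz]] : exists z, X 2 z /\ u [set y | X 9 (z * g * y / l)].
  exact: bu_meet ellis_u2 h.
have [y [/= Ly Xy]] := bu_meet ul uz.
have -> : g = z^-1 * ((z * g * y / l) / (y / l)).
  by rewrite invgM invgK !mulgA mulgVK mulgK mulVg mul1g.
apply: (@expsetD _ _ 2 10); first exact: expsetV.
exact: (@expset_div 9 1).
Qed.

End Estimates.

(** * Definable separation *)

Section Definability.
Context {G : groupType} (L : set G).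
Local Notation X n := (expset L n).
Hypothesis approxL : approximate_subgroup L.
Hypothesis genL : generated_by L.

Definition expset_elt n g (Xg : X n g) : X n :=
  exist (fun x => x \in X n) g (mem_set Xg).

Lemma foterm_pad n (t : foterm n) N : (n <= N)%N -> exists t' : foterm N,
  (forall v : valuation L, foterm_eval v t' = foterm_eval v t) /\
  foterm_vars t' = foterm_vars t.
Proof.
move=> /subnK <-; elim: (N - n)%N => [|m [t' [e e']]]; first by exists t.
by exists (FoIncl t').
Qed.

(* The variables of index 0 and 1 are left to the free variable and to the
   quantifier of the formulas below. *)
Definition param_var (p : fovar) := (p.1 == 1%N) && (2 <= p.2)%N.

Lemma product_term n k : X n.+1 k -> exists ps : seq G,
  (forall a, a \in ps -> L a) /\
  forall v : valuation L,
    (forall a, a \in ps -> exists2 p, param_var p & val (v p) = a) ->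
    exists2 t : foterm n.+1, {subset foterm_vars t <= param_var} &
      forall w : valuation L, (forall p, param_var p -> w p = v p) ->
        foterm_eval w t = k.
Proof.
elim: n k => [|n IH] k.
  move=> Lk; exists [:: k]; split; first by move=> a; rewrite inE => /eqP->.
  move=> v /(_ k (mem_head _ _))[[p1 j] /andP[/eqP/= e j2]].
  rewrite e in j2 *; move=> vk.
  exists (FoVar (1%N, j)).
    by move=> q; rewrite inE => /eqP->; rewrite /param_var /in_mem /= j2.
  by move=> w wv; rewrite /= wv.
rewrite expsetS => -[a La [b /IH[ps [psL psP]] <-]].
exists (a :: ps); split.
  by move=> c; rewrite inE => /predU1P[->|/psL].
move=> v vP; have [|t tP te] := psP v.
  by move=> c cps; apply: vP; rewrite inE cps orbT.
have [[p1 j] /andP[/= /eqP e j2]] := vP a (mem_head _ _).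
rewrite e in j2 *; move=> va.
exists (FoMul (FoVar (1%N, j)) t : foterm n.+2).
  move=> q; rewrite inE => /predU1P[->|/tP//].
  by rewrite /param_var /in_mem /= j2.
by move=> w wv; rewrite /= wv //= va te.
Qed.

Definition defines n (v : valuation L) (D : set G) (phi : foformula) :=
  (forall p, p \in free_vars phi -> p != (n, 0%N) -> p.1 = 1%N) /\
  forall a : X n, D (val a) <-> holds (dfwith v (n, 0%N) a) phi.

(** The formula may depend on where a valuation stores the parameters [ps]. Lists of parameters can
    thus be concatenated, and Boolean combinations share one valuation. *)
Definition definable n (D : set G) := D `<=` X n /\
  exists2 ps : seq G, (forall a, a \in ps -> L a) &
    forall v : valuation L,
      (forall a, a \in ps -> exists2 p, param_var p & val (v p) = a) ->
      exists phi, defines n v D phi.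

Lemma definableT n : definable n (X n).
Proof.
split=> //; exists [::] => // v _; exists (FoImp FoFalse FoFalse).
by split=> // a; split=> [_ []|_]; exact: set_mem (valP a).
Qed.

Lemma definableC n D : definable n D -> definable n (X n `\` D).
Proof.
move=> [DX [ps psL psP]]; split; first exact: subDsetl.
exists ps => // v /psP[phi [fv dphi]]; exists (FoImp phi FoFalse); split.
  by move=> p; rewrite /= cats0; exact: fv.
move=> a; split=> [[_ nD] /= /dphi//|/= nphi].
by split; [exact: set_mem (valP a)|move=> /dphi].
Qed.

Lemma definableI n D D' : definable n D -> definable n D' ->
  definable n (D `&` D').
Proof.
move=> [DX [ps psL psP]] [DX' [ps' psL' psP']]; split.
  by move=> x [/DX].
exists (ps ++ ps') => [a|v vP].
  by rewrite mem_cat => /orP[/psL|/psL'].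
have [a aps|phi [fv dphi]] := psP v; first by apply: vP; rewrite mem_cat aps.
have [a aps|psi [fv' dpsi]] := psP' v.
  by apply: vP; rewrite mem_cat aps orbT.
exists (FoImp (FoImp phi (FoImp psi FoFalse)) FoFalse); split.
  by move=> p; rewrite /= !cats0 mem_cat => /orP[/fv|/fv'].
move=> a; split=> [[/dphi h /dpsi h'] /= hh|/= hh]; first exact: hh.
by split; [apply/dphi|apply/dpsi]; apply: contrapT => nh; apply: hh => // _ ?.
Qed.

(** The formula says that [k * g = y * k'] for some [y] in [L], with [k] and [k'] written as
    products of parameters and the existential as a negated universal. *)
Lemma definable_translate n k k' :
  definable n (X n `&` [set g | L (k * g / k')]).
Proof.
have sub1 m g : X m g -> X m.+1 g by apply: expset_sub.
have [a /sub1 Xk] := expset_all approxL genL k.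
have [b /sub1 Xk'] := expset_all approxL genL k'.
have [ps [psL psP]] := product_term Xk.
have [ps' [psL' psP']] := product_term Xk'.
split; first exact: subIsetl.
exists (ps ++ ps') => [c|v vP].
  by rewrite mem_cat => /orP[/psL|/psL'].
have [c cps|t tv te] := psP v; first by apply: vP; rewrite mem_cat cps.
have [c cps|t' tv' te'] := psP' v.
  by apply: vP; rewrite mem_cat cps orbT.
pose N := maxn (a.+1 + n) (1 + b.+1).
have [s [se sv]] :=
  foterm_pad (FoMul t (FoVar (n, 0%N))) (leq_maxl _ _ : _ <= N)%N.
have [s' [se' sv']] :=
  foterm_pad (FoMul (FoVar (1%N, 1%N)) t') (leq_maxr _ _ : _ <= N)%N.
exists (FoImp (FoForall (1%N, 1%N) (FoImp (FoEq s s') FoFalse)) FoFalse).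
split.
  move=> p; rewrite /= !cats0 mem_filter sv sv' /= mem_cat.
  rewrite mem_cat !inE => /andP[/negPf->] /= /orP[/orP[/tv|->//]|/tv'];
  by rewrite /in_mem /= => /andP[/eqP->].
move=> x.
pose w y := dfwith (dfwith v (n, 0%N) x) (1%N, 1%N) y.
have wparam y p : param_var p -> w y p = v p.
  move=> /andP[/= p1 p2]; rewrite /w !dfwithout //.
    by apply: contraTN p2 => /eqP<-.
  by apply: contraTN p2 => /eqP<-.
have wx y : w y (n, 0%N) = x.
  rewrite /w dfwithout ?dfwithin //.
  by apply/eqP => -[].
have wy y : w y (1%N, 1%N) = y by rewrite /w dfwithin.
have sE y : foterm_eval (w y) s = k * val x.
  by rewrite se /= te ?wx // => p; exact: wparam.
have sE' y : foterm_eval (w y) s' = val y * k'.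
  by rewrite se' /= te' ?wy // => p; exact: wparam.
split=> [[_ /= Lx] /= h|/= h].
  pose y : X 1 := expset_elt (n := 1) Lx.
  by apply: (h y); rewrite -/(w y) sE sE' /= mulgVK.
split; first exact: set_mem (valP x).
apply: contrapT => nLx; apply: h => y; rewrite -/(w y) sE sE' => e.
by apply: nLx; rewrite e mulgK; exact: set_mem (valP y).
Qed.

Lemma definable_definable_subset n D : definable n D -> definable_subset L n D.
Proof.
move=> [DX [ps psL psP]].
(* Parameters are stored from index 2 on; all other variables get the value 1, which lies in every
   sort. *)
pose r (p : fovar) : G := if p.1 == 1%N then nth 1 ps (p.2 - 2) else 1.
have rX p : X p.1 (r p).
  rewrite /r; case: eqP => [->|_]; last exact: expset1.
  have [lt|ge] := ltnP (p.2 - 2) (size ps); first exact/psL/mem_nth.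
  by rewrite nth_default //; exact: (expset1 approxL 1).
pose v : valuation L := fun p => expset_elt (rX p).
have [a aps|phi [fv dphi]] := psP v.
  exists (1%N, (index a ps + 2)%N); first by rewrite /param_var /= leq_addl.
  by rewrite /= /r /= addnK nth_index.
exists phi, v; split=> //; apply/seteqP; split=> x.
  move=> Dx; exists (expset_elt (DX _ Dx)) => //=.
  by apply/dphi.
by move=> [a /dphi Da <-].
Qed.

(** Without a separating set, some [p'] contains [A'] and every definable set around [A]. Then some
    [p] contains [A] and every definable set of [p'], so no translate of [L] distinguishes [p] from
    [p']. *)
Lemma definable_separation n (A A' : set G) : A `<=` X n -> A' `<=` X n ->
  (forall p p' : bultra L, p A -> p' A' -> exists k k',
     p [set g | L (k * g / k')] /\ ~ p' [set g | L (k * g / k')]) ->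
  exists2 D, definable n D & A `<=` D /\ D `&` A' = set0.
Proof.
move=> AX AX' sep; apply: contrapT => nD.
have [|||p' up' Fp'] := @ultra_ex G [set B | exists2 D, definable n D &
    A `<=` D /\ D `&` A' `<=` B].
- by exists setT, (X n) => //; exact: definableT.
- move=> B B' [D dD [AD DB]] [D' dD' [AD' DB']].
  exists (D `&` D'); first exact: definableI.
  split; first by move=> x Ax; split; [exact: AD|exact: AD'].
  by move=> x [[Dx D'x] A'x]; split; [exact: DB|exact: DB'].
- move=> B [D dD [AD DB]]; apply: contrapT => B0; apply: nD; exists D => //.
  split=> //; apply/seteqP; split=> // x Dx; apply: B0; exists x; exact: DB.
have pp' := @ultra_proper _ _ up'.
have p'A' : p' A'.
  by apply: Fp'; exists (X n); [exact: definableT|split=> // x []].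
have p'X : p' (X n) by apply: filterS p'A'.
have [|||p up Fp] := @ultra_ex G [set B | exists2 D, definable n D &
    p' D /\ D `&` A `<=` B].
- by exists setT, (X n) => //; exact: definableT.
- move=> B B' [D dD [pD DB]] [D' dD' [pD' DB']].
  exists (D `&` D'); first exact: definableI.
  split; first exact: filterI.
  by move=> x [[Dx D'x] A'x]; split; [exact: DB|exact: DB'].
- move=> B [D dD [pD DB]]; apply: contrapT => B0.
  have : p' ((X n `\` D) `&` A').
    apply: Fp'; exists (X n `\` D); first exact: definableC.
    split=> // x Ax; split; first exact: AX.
    by move=> Dx; apply: B0; exists x; exact: DB.
  by move=> /(filterI pD)/filter_ex[x [Dx [[]]]].
have pA : p A by apply: Fp; exists (X n); [exact: definableT|split=> // x []].
have pp := @ultra_proper _ _ up.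
have bp : exists m, p (X m) by exists n; apply: filterS pA.
have bp' : exists m, p' (X m) by exists n.
have [k [k' [/= pk npk]]] := sep (BUltra up bp) (BUltra up' bp') pA p'A'.
have dk := definable_translate n k k'.
have [p'k|p'k] := in_ultra_setVsetC (X n `&` [set g | L (k * g / k')]) up'.
  by apply: npk; apply: filterS p'k => g [].
have : p ((X n `\` (X n `&` [set g | L (k * g / k')])) `&` A).
  apply: Fp; exists (X n `\` (X n `&` [set g | L (k * g / k')])).
    exact: definableC.
  by split=> //; apply: filterI.
by move=> /(filterI pk)/filter_ex[g [Lg [[Xg nXL] _]]]; apply: nXL.
Qed.

End Definability.

(** * Closures in topological groups, and the construction of [H], [Sh] and [f] *)

Lemma cvg_topological_mulg (H : topologicalGroupType) (X : Type)
    (F : set_system X) (f g : X -> H) (a b : H) :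
  Filter F -> f @ F --> a -> g @ F --> b -> (fun x => f x * g x) @ F --> a * b.
Proof.
move=> FF fa gb.
exact: (@continuous2_cvg _ _ _ _ F FF f g (fun x y : H => x * y) a b
  (@mulg_continuous H (a, b))).
Qed.

Lemma closure_normal (H : topologicalGroupType) (A : set H) :
  normal_subset A -> normal_subset (closure A).
Proof.
move=> nA x y clx B nB.
have c : (fun z : H => y^-1 * (z * y)) @ x --> y^-1 * (x * y).
  apply: cvg_topological_mulg; first exact: cvg_cst.
  by apply: cvg_topological_mulg; [exact: cvg_id|exact: cvg_cst].
have [z [Az Bz]] := clx _ (c _ nB).
by exists (z ^ y); split=> //; exact: nA.
Qed.

Lemma closure_translate (H : topologicalGroupType) (A P : set H) (x : H) :
  nbhs (1 : H) P -> closure A x -> exists2 a, A a & P (a^-1 * x).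
Proof.
move=> nP clx.
have c : (fun z : H => z^-1 * x) @ x --> x^-1 * x.
  apply: cvg_topological_mulg; first exact: invg_continuous.
  exact: cvg_cst.
rewrite mulVg in c; have [a [Aa Pa]] := clx _ (c _ nP).
by exists a.
Qed.

Theorem theorem4p2 (G : groupType) (L : set G)
    (approxL : approximate_subgroup L) (genL : generated_by L) :
  exists (H : topologicalGroupType) (Sh : set H) (f : G -> H),
    [/\ second_countable (T := H), locally_compact [set: H]
      & hausdorff_space H] /\
    [/\ compact Sh, normal_subset Sh & quasi_homomorphism Sh f] /\
    [/\ (forall C : set H, compact C ->
           exists i : nat, f @^-1` C `<=` expset L i),
        (forall i : nat, exists C : set H,
           compact C /\ expset L i `<=` f @^-1` C),
        f @^-1` Sh `<=` expset L 12
      & forall X X' : set H, compact X -> compact X' ->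
          mulset (expset Sh 2) X `&` mulset (expset Sh 2) X' = set0 ->
          exists (k : nat) (D D' : set G),
            [/\ definable_subset L k D, definable_subset L k D',
                D `&` D' = set0, f @^-1` X `<=` D & f @^-1` X' `<=` D']].
Proof.
have [u uu uinv] := minimal_idempotent approxL.
pose mi := MinIdem uu uinv.
pose T := topologized (tau mi).
pose F : G -> T := ellis_map approxL genL mi.
have [l ul] := bu_cover approxL u.
pose W : set T := @ellis_nb G L mi l.
pose K n : set T := tau_comp n.
have mK n m : (n <= m)%N -> K n `<=` K m.
  move=> nm a Ka Y uY; apply: buS (Ka Y uY) => _ [g Yg [h Xh <-]].
  by exists g => //; exists h => //; exact: (expset_sub approxL nm).
have Kb n (a : T) : K n a -> ev a (expset L (2 + n)).
  move=> Ka; apply: buS (Ka _ (ellis_u2 approxL genL mi)).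
  by move=> _ [g Xg [h Xh <-]]; exact: expsetD.
have nK (a : T) : exists n, nbhs a (K n).
  have [n an] := bu_bounded (ev a); exists (2 + n).
  apply: filterS (tau_nb_nbhs an (ellis_u2 approxL genL mi)) => b [g Xg bg].
  apply: sub_tau_comp; apply: buS bg => h Xgh.
  by rewrite -(mulKg g h); apply: expsetD => //; exact: expsetV.
have cK n : compact (K n) by exact: tau_comp_compact.
have nW : nbhs (1 : T) W by apply: tau_nb_nbhs => //; rewrite ev_one.
have [H [pi [[scH lcH hH] [piM pi_surj pi_cont pi_nbhs [P nP PW]]]]] :=
  second_countable_quotient cK mK nK nW.
have pi1 : pi 1 = 1 by apply: (@mulgI _ (pi 1)); rewrite -piM !mulg1.
have piV x : pi x^-1 = (pi x)^-1.
  by apply: (@mulgI _ (pi x)); rewrite -piM !mulgV.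
have [m mW] := closure_ellis_nb_bounded approxL genL (mi := mi) ul.
pose B : set T := @bounded_conj G L mi.
pose Sh := closure (pi @` B).
pose f g := pi (F g).
have cpi (A : set T) : compact A -> compact (pi @` A).
  by apply: continuous_compact; exact: continuous_subspaceT.
have FX n g : expset L n g -> K (n + 4) (F g).
  by move=> Xg; apply: sub_tau_comp; exact: ellis_map_expset.
(* A single [pi (K n)] contains [C]. If [f g = pi a] with [a] in [K n], then [a^-1 * F g] lies over
   1, hence in the closure of [W], which is bounded by [X m]. *)
have bounded (C : set H) : compact C -> exists i, f @^-1` C `<=` expset L i.
  move=> /compact_near_coveringP cC.
  have : \forall n \near \oo, C `<=` pi @` K n.
    apply: (cC nat \oo (fun n => pi @` K n)) => h _.
    have [x <-] := pi_surj h; have [j nj] := nK x.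
    exists (pi @` K j, [set n | (j <= n)%N]) => /=.
      by split; [exact: pi_nbhs|exact: nbhs_infty_ge].
    by move=> [_ n] [[y Ky <-] /= jn]; exists y => //; exact: mK jn _ Ky.
  move=> /filter_ex[n Cn]; exists (2 + n + m + 4) => g /Cn[a Ka pia].
  apply: (ellis_map_expset_inv (genL := genL) (mi := mi)) => //.
  have -> : ellis_map approxL genL mi g = a * (a^-1 * F g) by rewrite mulVKg.
  rewrite ev_mul; have aX := Kb _ _ Ka.
  have wX : ev (a^-1 * F g) (expset L m).
    apply: mW; apply: PW; rewrite /= piM piV pia mulVg.
    exact: nbhs_singleton nP.
  by apply: buS aX => x Xx; apply: buS wX => y Xy; exact: expsetD.
(* [F] converges along [p] already in the Ellis group, by compactness of [K (n + 4)]; the limit lies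
   over [X] because [X] is closed. *)
have lim n (X : set H) (p : bultra L) : compact X -> p (f @^-1` X) ->
    f @^-1` X `<=` expset L n ->
    exists2 b : T, X (pi b) & ellis_lim b p.
  move=> cX pX Xn; have up := bu_ultra p.
  have [|b Kb' Fb] := @compact_ultra_lim _ _ _ p F
    (cK (n + 4)%N) up.
    by apply: buS pX => g /Xn/FX.
  exists b; last by apply: ellis_lim_cvg => A /Fb.
  apply: contrapT => nXb; have cl := compact_closed hH cX.
  have nb : nbhs b (pi @^-1` ~` X).
    apply: pi_cont; apply: open_nbhs_nbhs; split=> //; exact: closed_openC.
  by have [g [Xg]] := bu_meet pX (Fb _ nb); apply.
have Sh1 : Sh 1.
  by apply: subset_closure; exists 1 => //; exact: bounded_conj1.
exists H, Sh, f; split=> //; split; split.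
- apply: (subclosed_compact _ (cpi _ (@cK 6))).
    exact: closed_closure.
  have cl := compact_closed hH (cpi _ (@cK 6)).
  rewrite [X in _ `<=` X](closure_id _).1 //; apply: closureS.
  move=> _ [c cB <-]; exists c => //; apply: sub_tau_comp.
  by have := cB 1; rewrite conjg1.
- apply: closure_normal => _ y [c cB <-]; have [z <-] := pi_surj y.
  exists (c ^ z); first exact: bounded_conj_normal.
  by rewrite !conjgE !piM piV.
- split=> [|x y]; first by rewrite /f /F ellis_map1.
  exists (pi ((F x * F y^-1)^-1 * F (x * y^-1))).
    by apply: subset_closure; eexists; last reflexivity; exact: ellis_map_error.
  by rewrite /f -!piM mulVKg.
- exact: bounded.
- move=> i; exists (pi @` K (i + 4)); split.
    by apply: cpi; exact: cK.
  by move=> g Xg; exists (F g) => //; exact: FX.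
(* Passing from the closure to [pi c] leaves a factor in [P], which lifts to the closure of [W] and
   is already counted in the exponent 12. *)
- move=> g /(closure_translate nP)[_ [c cB <-]]; rewrite /f -piV -piM => Pw.
  apply: (ellis_map_bounded_conj (genL := genL) (mi := mi) ul cB (PW _ Pw)).
  by rewrite mulVKg.
move=> X X' cX cX' XX'.
have [i Xi] := bounded X cX; have [j Xj] := bounded X' cX'.
pose n := maxn i j.
have Xn : f @^-1` X `<=` expset L n.
  by apply: subset_trans Xi _; apply: (expset_sub approxL); exact: leq_maxl.
have Xn' : f @^-1` X' `<=` expset L n.
  by apply: subset_trans Xj _; apply: (expset_sub approxL); exact: leq_maxr.
have [|D dD [XD DX']] := definable_separation approxL genL Xn Xn'.
  move=> p p' pX pX'; apply: contrapT => npp'.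
  have pp' k k' : p [set g | L (k * g / k')] -> p' [set g | L (k * g / k')].
    by move=> pk; apply: contrapT => np'k; apply: npp'; exists k, k'.
  have [b Xb bp] := lim n X p cX pX Xn.
  have [b' Xb' bp'] := lim n X' p' cX' pX' Xn'.
  have cB := ellis_lim_close approxL genL bp bp' pp'.
  (* [pi b'] is the product of [pi (b' / b)], in [Sh], and [pi b], in [X]; it also lies in [X'].
     Factors 1 fill up the squares of [Sh]. *)
  suff : set0 (pi b') by [].
  rewrite -XX'; split.
    exists (pi (b' / b)); last first.
      by exists (pi b) => //; rewrite -piM mulgVK.
    exists 1 => //; exists (pi (b' / b)); last by rewrite mul1g.
    by apply: subset_closure; exists (b' / b).
  exists 1; first by exists 1 => //; exists 1 => //; rewrite mulg1.
  by exists (pi b') => //; rewrite mul1g.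
exists n, D, (expset L n `\` D); split=> //.
- exact: definable_definable_subset.
- by apply: definable_definable_subset => //; exact: definableC.
- by apply/seteqP; split=> // x [Dx []].
- move=> g Xg; split; first exact: Xn'.
  by move=> Dg; have : (D `&` f @^-1` X') g by []; rewrite DX'.
Qed.
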